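(* Let $\mathbb{K}$ be an algebraically closed field of characteristic zero and let $D$ be a simple derivation of $\mathbb{K}[x,y]$. Then $\mathrm{Aut}(D)=\{\mathrm{id}\}$.
   Context: A derivation of $\mathbb{K}[x,y]$ is a $\mathbb{K}$-linear map $D:\mathbb{K}[x,y]\to\mathbb{K}[x,y]$ with $D(fg)=gD(f)+fD(g)$. $D$ is simple if it does not stabilize any nontrivial ideal, i.e. there is no ideal $I$ with $(0)\neq I\neq \mathbb{K}[x,y]$ and $D(I)\subseteq I$. $\mathrm{Aut}(D)$ denotes the group of $\mathbb{K}$-algebra automorphisms $\rho$ of $\mathbb{K}[x,y]$ with $\rho D=D\rho$. *)

(* Defs.v *)
From HB Require Import structures.
From mathcomp Require Import all_boot all_order all_algebra.
From mathcomp Require Export mpoly.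
Set Implicit Arguments. Unset Strict Implicit. Unset Printing Implicit Defensive.
Import GRing.Theory.
Local Open Scope ring_scope.

(* K[x,y] is represented as {mpoly K[2]} (x = 'X_0, y = 'X_1). *)

Definition is_derivation (K : fieldType) (D : {mpoly K[2]} -> {mpoly K[2]}) : Prop :=
  (forall (c : K) (f g : {mpoly K[2]}), D (c *: f + g) = c *: D f + D g) /\
  (forall f g : {mpoly K[2]}, D (f * g) = g * D f + f * D g).

Definition is_ideal (R : comNzRingType) (I : R -> Prop) : Prop :=
  [/\ I 0, (forall a b, I a -> I b -> I (a + b)) & (forall r a, I a -> I (r * a))].

Definition simple_derivation (K : fieldType) (D : {mpoly K[2]} -> {mpoly K[2]}) : Prop :=
  forall I : {mpoly K[2]} -> Prop,
    is_ideal I ->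
    (exists f, I f /\ f <> 0) ->
    (exists f, ~ I f) ->
    ~ (forall f, I f -> I (D f)).

Definition is_Kalg_automorphism (K : fieldType) (rho : {mpoly K[2]} -> {mpoly K[2]}) : Prop :=
  [/\ (forall (c : K) (f g : {mpoly K[2]}), rho (c *: f + g) = c *: rho f + rho g),
      (forall f g : {mpoly K[2]}, rho (f * g) = rho f * rho g),
      rho 1 = 1 & bijective rho].

Definition in_Aut (K : fieldType) (D rho : {mpoly K[2]} -> {mpoly K[2]}) : Prop :=
  is_Kalg_automorphism rho /\ (forall f, rho (D f) = D (rho f)).

(* Main.v *)
Require Import Defs.
From HB Require Import structures.
From mathcomp Require Import all_boot all_order all_algebra.
From mathcomp Require Import mpoly.
From mathcomp Require Import zify ring.
Set Implicit Arguments. Unset Strict Implicit. Unset Printing Implicit Defensive.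
Import GRing.Theory.
Local Open Scope ring_scope.

(** Conjugating [rho] and [D] simultaneously, we may put [rho] in a normal form.
    By the Jung-van der Kulk theorem [rho] is a word in triangular automorphisms
    and the swap of the variables; after cyclic reduction it is either triangular
    or a composition of Henon maps (x, y) |-> (b y + c, a x + P(y)), deg P >= 2.

    Jung-van der Kulk: if [f] is a coordinate then [Jac(., f)] is locally
    nilpotent, hence so is [Jac(., F)] for the top form [F] of [f] with respect
    to any weights. Since the degree function of a locally nilpotent derivation is
    additive, [F] is forced to be a power of x + s y^k (or of its mirror image),
    and a triangular substitution lowers deg f.

    Triangular case: a fixed point of [rho] makes the ideal
    (rho x - x, rho y - y) proper and D-stable; the fixed point free normal forms
    each force an invariant curve of [D].

    Henon case: let u_j (j in Z) be the coordinates along the orbit, so that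
    u_(j+1) = Q_j(u_j) + d_j u_(j-1) and rho u_j = u_(j+n). The monomials in the
    u_j with every exponent of u_j less than deg Q_j span K[x, y], and far in the
    future (or in the past) their degrees are pairwise distinct, as in a mixed
    radix expansion. As [D] commutes with [rho] and raises degrees by at most a
    constant, only the monomials 1 and u_0 can occur in D u_0, so [D] has an
    invariant curve. *)

(** The statement is proved in a form that no longer mentions a given D: an automorphism commuting
    with some simple derivation is the identity. This form passes from a product of two
    automorphisms to the product in the other order, since D can be transported along; that is what
    lets words be rotated cyclically. An invariant curve is fatal because its equation generates a
    proper stable ideal. Characteristic zero keeps binomial coefficients nonzero, whence the
    additivity of the degree of a locally nilpotent derivation, and gives nonzero translations
    infinite order. Algebraic closedness supplies the s in x + s y^k, fixed points, and an
    eigenvector that makes an affine map triangular. In the Henon case, iterating [rho] forward only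
    excludes u_j with j > 0 and powers of u_0 above the first; the same argument on the reversed
    orbit excludes j < 0. Degree at least 2 of every P is the threshold: degrees then at least
    double at each step and outgrow any additive constant. *)

(** * Polynomials in x and y: substitution, derivations, total degree *)

Section PolynomialsInTwoVariables.
Variable K : fieldType.
Local Notation T := {mpoly K[2]}.
Implicit Types (p q f g h : T) (P Q : {poly K}) (rho D : T -> T).

Definition mX : T := 'X_ord0.
Definition mY : T := 'X_ord_max.
Definition dx p : T := p^`M(ord0).
Definition dy p : T := p^`M(ord_max).

HB.instance Definition _ := GRing.Linear.copy dx (mderiv ord0).
HB.instance Definition _ := GRing.Linear.copy dy (mderiv ord_max).

Lemma ord2P (i : 'I_2) : (i = ord0) + (i = ord_max).
Proof. by case: i => [[|[|//]] ?]; [left | right]; apply: val_inj. Qed.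

Lemma mpolyX2 (m : 'X_{1..2}) : 'X_[m] = mX ^+ m ord0 * mY ^+ m ord_max.
Proof.
rewrite mpolyXE_id 2!big_ord_recl big_ord0 mulr1.
by rewrite /mX /mY; congr (_ * 'X_(_) ^+ m _); apply: val_inj.
Qed.

Lemma mpoly2_ind (A : T -> Prop) :
  (forall c, A c%:MP) -> A mX -> A mY ->
  (forall p q, A p -> A q -> A (p + q)) ->
  (forall p q, A p -> A q -> A (p * q)) -> forall p, A p.
Proof.
move=> hC hX hY hD hM.
have Aexp p k : A p -> A (p ^+ k).
  move=> Ap; elim: k => [|k IH]; first by rewrite expr0 -mpolyC1.
  by rewrite exprS; apply: hM.
elim/mpolyind => [|c m p _ _ IH]; first by rewrite -mpolyC0.
apply: hD => //; rewrite -mul_mpolyC mpolyX2.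
by apply: (hM) => //; apply: (hM); apply: Aexp.
Qed.

Lemma submm n (m : 'X_{1..n}) : (m - m)%MM = 0%MM.
Proof. by rewrite -{1}[m]add0m addmK. Qed.

Lemma dxX : dx mX = 1.
Proof. by rewrite /dx mderivX mnm1E eqxx scale1r submm mpolyX0. Qed.
Lemma dxY : dx mY = 0.
Proof. by rewrite /dx mderivX mnm1E scale0r. Qed.
Lemma dyY : dy mY = 1.
Proof. by rewrite /dy mderivX mnm1E eqxx scale1r submm mpolyX0. Qed.
Lemma dyX : dy mX = 0.
Proof. by rewrite /dy mderivX mnm1E scale0r. Qed.
Lemma dxC c : dx c%:MP = 0.
Proof. exact: mderivC. Qed.
Lemma dyC c : dy c%:MP = 0.
Proof. exact: mderivC. Qed.
Lemma dxM p q : dx (p * q) = dx p * q + p * dx q.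
Proof. exact: mderivM. Qed.
Lemma dyM p q : dy (p * q) = dy p * q + p * dy q.
Proof. exact: mderivM. Qed.

Definition sub f g p : T := p \mPo [tuple f; g].
HB.instance Definition _ f g := GRing.LRMorphism.copy (sub f g) (comp_mpoly [tuple f; g]).

Lemma subX f g : sub f g mX = f.
Proof. by rewrite /sub comp_mpolyXU. Qed.
Lemma subY f g : sub f g mY = g.
Proof. by rewrite /sub comp_mpolyXU. Qed.
Lemma subC f g c : sub f g c%:MP = c%:MP.
Proof. by rewrite /sub comp_mpolyC. Qed.

Lemma rmorph2_ext (R : nzRingType) (F G : {rmorphism T -> R}) :
  (forall c, F c%:MP = G c%:MP) -> F mX = G mX -> F mY = G mY -> F =1 G.
Proof.
move=> eC eX eY; apply: mpoly2_ind => // p q ep eq.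
  by rewrite !rmorphD ep eq.
by rewrite !rmorphM ep eq.
Qed.

Lemma sub_id : sub mX mY =1 id.
Proof.
by apply: (@rmorph2_ext _ (sub mX mY) idfun) => [c||] /=;
   rewrite ?subC ?subX ?subY.
Qed.

Lemma lrmorphC (F : {lrmorphism T -> T}) c : F c%:MP = c%:MP.
Proof. by rewrite -[c%:MP]mulr1 mul_mpolyC linearZ /= rmorph1. Qed.

Lemma lrmorph_sub (F : {lrmorphism T -> T}) : F =1 sub (F mX) (F mY).
Proof.
by apply: rmorph2_ext => [c||] /=; rewrite ?lrmorphC ?subC ?subX ?subY.
Qed.

Lemma sub_sub f g f' g' p :
  sub f g (sub f' g' p) = sub (sub f g f') (sub f g g') p.
Proof.
by rewrite -[LHS]/((sub f g \o sub f' g') p) lrmorph_sub /= subX subY.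
Qed.

Lemma autE rho : is_Kalg_automorphism rho -> rho =1 sub (rho mX) (rho mY).
Proof.
case=> rhoL rhoM rho1 _.
have rhoD p q : rho (p + q) = rho p + rho q.
  by rewrite -[p]scale1r rhoL !scale1r.
have rho0 : rho 0 = 0.
  by apply: (addrI (rho 0)); rewrite -rhoD !addr0.
have rhoZ c p : rho (c *: p) = c *: rho p by rewrite -[c *: p]addr0 rhoL rho0 addr0.
apply: mpoly2_ind => [c|||p q ep eq|p q ep eq].
- by rewrite subC -[c%:MP]mulr1 mul_mpolyC rhoZ rho1.
- by rewrite subX.
- by rewrite subY.
- by rewrite rhoD ep eq rmorphD.
- by rewrite rhoM ep eq rmorphM.
Qed.

Lemma aut_sub f g f' g' :
  cancel (sub f g) (sub f' g') -> cancel (sub f' g') (sub f g) ->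
  is_Kalg_automorphism (sub f g).
Proof.
move=> c1 c2; split; first by move=> c p q; rewrite linearP.
- by move=> p q; rewrite rmorphM.
- by rewrite rmorph1.
- by exists (sub f' g').
Qed.

Lemma aut_comp rho rho' : is_Kalg_automorphism rho ->
  is_Kalg_automorphism rho' -> is_Kalg_automorphism (rho \o rho').
Proof.
move=> [L M e1 b] [L' M' e1' b']; split=> [c p q|p q||] /=.
- by rewrite L' L.
- by rewrite M' M.
- by rewrite e1' e1.
- exact: bij_comp.
Qed.

Lemma aut_inv rho : is_Kalg_automorphism rho -> exists rho',
  [/\ is_Kalg_automorphism rho', cancel rho rho' & cancel rho' rho].
Proof.
move=> [L M e1 [rho' c1 c2]]; exists rho'; split=> //; split.
- by move=> c p q; apply: (can_inj c1); rewrite L !c2.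
- by move=> p q; apply: (can_inj c1); rewrite M !c2.
- by apply: (can_inj c1); rewrite c2 e1.
- by exists rho.
Qed.

Lemma autC rho c : is_Kalg_automorphism rho -> rho c%:MP = c%:MP.
Proof. by move=> a; rewrite autE // subC. Qed.

Lemma aut_id : is_Kalg_automorphism (@id T).
Proof. by split=> //; exists id. Qed.

Section Derivation.
Variable D : T -> T.
Hypothesis derD : is_derivation D.

Lemma derB_lin c p q : D (c *: p + q) = c *: D p + D q.
Proof. by case: derD => + _; apply. Qed.
Lemma der_add p q : D (p + q) = D p + D q.
Proof. by have := derB_lin 1 p q; rewrite !scale1r. Qed.
Lemma der0 : D 0 = 0.
Proof. by apply: (addrI (D 0)); rewrite -der_add !addr0. Qed.
Lemma derZ c p : D (c *: p) = c *: D p.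
Proof. by rewrite -[c *: p]addr0 derB_lin der0 addr0. Qed.
Lemma derN p : D (- p) = - D p.
Proof. by rewrite -scaleN1r derZ scaleN1r. Qed.
Lemma derB p q : D (p - q) = D p - D q.
Proof. by rewrite der_add derN. Qed.
Lemma derM p q : D (p * q) = q * D p + p * D q.
Proof. by case: derD => _; apply. Qed.
Lemma derC c : D c%:MP = 0.
Proof.
have D1 : D 1 = 0.
  by apply: (addrI (D 1)); have := derM 1 1; rewrite !mul1r addr0.
by rewrite -[c%:MP]mulr1 mul_mpolyC derZ D1 scaler0.
Qed.

Lemma der_partial p : D p = dx p * D mX + dy p * D mY.
Proof.
move: p; apply: mpoly2_ind => [c|||p q ep eq|p q ep eq].
- by rewrite derC dxC dyC; ring.
- by rewrite dxX dyX; ring.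
- by rewrite dxY dyY; ring.
- by rewrite der_add ep eq !raddfD /=; ring.
- by rewrite derM ep eq dxM dyM; ring.
Qed.
End Derivation.

Lemma dx_sub f g p : dx (sub f g p) = sub f g (dx p) * dx f + sub f g (dy p) * dx g.
Proof.
move: p; apply: mpoly2_ind => [c|||p q ep eq|p q ep eq].
- by rewrite subC dxC dyC rmorph0; ring.
- by rewrite subX dxX dyX rmorph0 rmorph1; ring.
- by rewrite subY dxY dyY rmorph0 rmorph1; ring.
- by rewrite !rmorphD /= !raddfD /= ep eq; ring.
- by rewrite rmorphM /= !dxM dyM !rmorphD !rmorphM /= ep eq; ring.
Qed.

Lemma dy_sub f g p : dy (sub f g p) = sub f g (dx p) * dy f + sub f g (dy p) * dy g.
Proof.
move: p; apply: mpoly2_ind => [c|||p q ep eq|p q ep eq].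
- by rewrite subC dxC dyC rmorph0; ring.
- by rewrite subX dxX dyX rmorph0 rmorph1; ring.
- by rewrite subY dxY dyY rmorph0 rmorph1; ring.
- by rewrite !rmorphD /= !raddfD /= ep eq; ring.
- by rewrite rmorphM /= !dxM dyM !rmorphD !rmorphM /= ep eq !dyM; ring.
Qed.

Definition ev P q : T := horner_alg q P.

Lemma evX q : ev 'X q = q.
Proof. by rewrite /ev horner_algX. Qed.
Lemma evC c q : ev c%:P q = c%:MP.
Proof. by rewrite /ev horner_algC -mul_mpolyC mulr1. Qed.
Lemma evD P Q q : ev (P + Q) q = ev P q + ev Q q.
Proof. exact: (rmorphD (horner_alg q)). Qed.
Lemma evB P Q q : ev (P - Q) q = ev P q - ev Q q.
Proof. exact: (rmorphB (horner_alg q)). Qed.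
Lemma evN P q : ev (- P) q = - ev P q.
Proof. exact: (rmorphN (horner_alg q)). Qed.
Lemma evM P Q q : ev (P * Q) q = ev P q * ev Q q.
Proof. exact: (rmorphM (horner_alg q)). Qed.
Lemma evZ c P q : ev (c *: P) q = c *: ev P q.
Proof. by rewrite -mul_polyC evM evC mul_mpolyC. Qed.
Lemma evXn n q : ev 'X^n q = q ^+ n.
Proof. by rewrite /ev rmorphXn /= horner_algX. Qed.
Lemma ev0 q : ev 0 q = 0.
Proof. exact: (rmorph0 (horner_alg q)). Qed.

Lemma sub_ev f g P q : sub f g (ev P q) = ev P (sub f g q).
Proof.
elim/poly_ind: P => [|P c IH]; first by rewrite !ev0 rmorph0.
by rewrite !(evD, evM, evC, evX) rmorphD rmorphM /= subC IH.
Qed.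

Lemma der_ev D P q : is_derivation D -> D (ev P q) = ev P^`() q * D q.
Proof.
move=> dD; elim/poly_ind: P => [|P c IH].
  by rewrite deriv0 !ev0 der0 // mul0r.
rewrite derivD derivM derivX derivC addr0 mulr1.
rewrite !(evD, evM, evC, evX) der_add // derM // derC // IH.
by ring.
Qed.

Lemma is_der_dx : is_derivation dx.
Proof. by split=> [c p q|p q]; rewrite ?linearP // dxM; ring. Qed.
Lemma is_der_dy : is_derivation dy.
Proof. by split=> [c p q|p q]; rewrite ?linearP // dyM; ring. Qed.

(** Zero gets degree 0 like the other constants, so a positive degree certifies that a polynomial is
    not constant. *)
Definition deg p := (msize p).-1.

Lemma degC c : deg c%:MP = 0%N.
Proof. by rewrite /deg msizeC; case: (_ != _). Qed.
Lemma deg0 : deg 0 = 0%N.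
Proof. by rewrite /deg msize0. Qed.
Lemma degX : deg mX = 1%N.
Proof. by rewrite /deg msizeX mdeg1. Qed.
Lemma degY : deg mY = 1%N.
Proof. by rewrite /deg msizeX mdeg1. Qed.

Lemma degM p q : p != 0 -> q != 0 -> deg (p * q) = (deg p + deg q)%N.
Proof.
move=> p0 q0; rewrite /deg msizeM //.
by rewrite (mpolySpred _ p0) (mpolySpred _ q0) addnS addSn.
Qed.

Lemma degM_le p q : (deg (p * q) <= deg p + deg q)%N.
Proof.
have [->|p0] := eqVneq p 0; first by rewrite mul0r deg0.
have [->|q0] := eqVneq q 0; first by rewrite mulr0 deg0.
by rewrite degM.
Qed.

Lemma degN p : deg (- p) = deg p.
Proof. by rewrite /deg msizeN. Qed.

Lemma degD_le p q : (deg (p + q) <= maxn (deg p) (deg q))%N.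
Proof. by have := msizeD_le p q; rewrite /deg; lia. Qed.

Lemma degDr p q : (deg p < deg q)%N -> deg (p + q) = deg q.
Proof.
move=> lt; apply/eqP; rewrite eqn_leq; apply/andP; split.
  by have := degD_le p q; lia.
have := degD_le (p + q) (- p); rewrite degN [_ - p]addrAC subrr add0r; lia.
Qed.

Lemma degZ c p : c != 0 -> deg (c *: p) = deg p.
Proof. by move=> c0; rewrite /deg msizeZ. Qed.

Lemma degZ_le c p : (deg (c *: p) <= deg p)%N.
Proof.
by have [->|c0] := eqVneq c 0; [rewrite scale0r deg0 | rewrite degZ].
Qed.

Lemma deg_gt0_neq0 p : (0 < deg p)%N -> p != 0.
Proof. by apply: contraTneq => ->; rewrite deg0. Qed.

Lemma deg0_const p : deg p = 0%N -> p = (p@_0)%:MP.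
Proof. by move=> d0; apply: msize1_polyC; rewrite /deg in d0; lia. Qed.

Lemma deg_ev P q : (0 < deg q)%N -> P != 0 ->
  ev P q != 0 /\ deg (ev P q) = ((size P).-1 * deg q)%N.
Proof.
move=> q0; elim/poly_ind: P => [|P c IH]; first by rewrite eqxx.
have [->|P0] := eqVneq P 0.
  rewrite mul0r add0r polyC_eq0 evC mpolyC_eq0 => c0; split=> //.
  by rewrite degC size_polyC c0.
have [e0 eqd] := IH P0; move=> _.
have szP : (0 < size P)%N by rewrite size_poly_gt0.
rewrite size_MXaddC (negPf P0) /= evD evM evC evX addrC.
have dM : deg (ev P q * q) = (size P * deg q)%N.
  by rewrite (degM e0 (deg_gt0_neq0 q0)) eqd; move: szP; case: (size P) => // k _; rewrite mulSn addnC.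
have lt : (0 < deg (ev P q * q))%N by rewrite dM muln_gt0 szP.
have -> : deg (c%:MP + ev P q * q) = deg (ev P q * q).
  by apply: degDr; rewrite degC.
split=> //; apply: deg_gt0_neq0; rewrite degDr //; by rewrite degC.
Qed.

Lemma deg_mderiv i p : (deg p^`M(i) <= deg p)%N.
Proof.
rewrite /mderiv big_seq; elim/big_ind: _ => [|a b|m mp]; first by rewrite deg0.
  by move=> ha hb; apply: leq_trans (degD_le _ _) _; rewrite geq_max ha hb.
apply: leq_trans (degZ_le _ _) _; rewrite /deg msizeX /=.
have := msize_mdeg_lt mp; suff : (mdeg (m - U_(i)) <= mdeg m)%N by lia.
exact: mdegB.
Qed.

Lemma dy_ev P q : dy (ev P q) = ev P^`() q * dy q.
Proof. exact: der_ev is_der_dy. Qed.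

End PolynomialsInTwoVariables.

(** * Sums of terms with pairwise distinct values *)

Section DegreeLike.
Variables (K : fieldType) (v : {mpoly K[2]} -> nat).
Local Notation T := {mpoly K[2]}.
Hypothesis v0 : v 0 = 0%N.
Hypothesis vN : forall p, v (- p) = v p.
Hypothesis vD_le : forall p q, (v (p + q) <= maxn (v p) (v q))%N.

Lemma valD_neq p q : v p <> v q -> v (p + q) = maxn (v p) (v q).
Proof.
move=> ne; have h := vD_le p q.
have := vD_le (p + q) (- p); have := vD_le (p + q) (- q).
rewrite !vN addrK [p + q - p]addrAC subrr add0r; lia.
Qed.

(** Distinct values cannot cancel, so the sum takes the largest of them. This serves for [nu] on the
    monomials of an edge form and for the total degree on monomials along an orbit. *)
Lemma val_sum_distinct (I : eqType) (r : seq I) (F : I -> T) :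
  uniq [seq v (F i) | i <- r] ->
  {in r, forall i, (v (F i) <= v (\sum_(j <- r) F j))%N}.
Proof.
(* The induction also records that the value of the sum is one of the listed values; this keeps it
   different from the value of the next term. *)
suff H : uniq [seq v (F i) | i <- r] ->
    {in r, forall i, (v (F i) <= v (\sum_(j <- r) F j))%N} /\
    (r != [::] -> v (\sum_(j <- r) F j) \in [seq v (F i) | i <- r]).
  by move=> /H [].
elim: r => [|j r IH] //= /andP[jr ur]; have [IH1 IH2] := IH ur.
rewrite big_cons; have [->|r0] := eqVneq r [::].
  rewrite big_nil addr0; split=> [i|_]; last by rewrite inE.
  by rewrite inE => /eqP ->.
have {IH2} IH2 := IH2 r0.
have ne : v (F j) <> v (\sum_(i <- r) F i) by move=> e; rewrite e IH2 in jr.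
rewrite (valD_neq ne); split=> [i|_].
  rewrite inE => /orP[/eqP ->|ir]; first by rewrite leq_maxl.
  by apply: leq_trans (IH1 i ir) _; rewrite leq_maxr.
rewrite inE /maxn; case: ifP => _; first by rewrite IH2 orbT.
by rewrite eqxx.
Qed.
End DegreeLike.

(** * Locally nilpotent derivations and their degree function *)

Section LocallyNilpotent.
Variable K : fieldType.
Local Notation T := {mpoly K[2]}.
Implicit Types (p q f g h : T).
Variable D : T -> T.
Hypothesis dD : is_derivation D.

Lemma iter_derD n p q : iter n D (p + q) = iter n D p + iter n D q.
Proof. by elim: n => //= n ->; rewrite der_add. Qed.
Lemma iter_der0 n : iter n D 0 = 0.
Proof. by elim: n => //= n ->; rewrite der0. Qed.
Lemma iter_derZ n c p : iter n D (c *: p) = c *: iter n D p.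
Proof. by elim: n => //= n ->; rewrite derZ. Qed.

Lemma derMn p n : D (p *+ n) = D p *+ n.
Proof. by elim: n => [|n IH]; rewrite ?mulr0n ?der0 // !mulrS der_add // IH. Qed.

Lemma der_sum (I : Type) (r : seq I) (F : I -> T) :
  D (\sum_(i <- r) F i) = \sum_(i <- r) D (F i).
Proof.
by elim: r => [|i r IH]; rewrite ?big_nil ?der0 // !big_cons der_add // IH.
Qed.

Lemma iter_derM n p q : iter n D (p * q) =
  \sum_(i < n.+1) (iter i D p * iter (n - i) D q) *+ 'C(n, i).
Proof.
elim: n => [|n IH]; first by rewrite big_ord_recl big_ord0 /= addr0.
rewrite /= IH der_sum.
transitivity (\sum_(i < n.+1) (iter i.+1 D p * iter (n - i) D q) *+ 'C(n, i) +
              \sum_(i < n.+1) (iter i D p * iter (n.+1 - i) D q) *+ 'C(n, i)).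
  rewrite -big_split /=; apply: eq_bigr => i _.
  rewrite derMn derM // mulrnDl subSn /=; last by rewrite -ltnS.
  by rewrite mulrC.
rewrite [in RHS]big_ord_recl /= ?bin0 ?subn0 ?mulr1n.
rewrite [X in _ + X]big_ord_recl /= ?bin0 ?subn0 ?mulr1n.
rewrite [X in _ = _ + X](eq_bigr (fun i : 'I_n.+1 =>
   (iter i.+1 D p * iter (n - i) D q) *+ 'C(n, i.+1) +
   (iter i.+1 D p * iter (n - i) D q) *+ 'C(n, i))); last first.
  by move=> i _; rewrite /bump /= add1n subSS binS mulrnDr.
rewrite big_split /= [X in _ = _ + (X + _)]big_ord_recr /=.
rewrite (bin_small (leqnn n.+1)) mulr0n addr0.
by rewrite addrC -addrA; congr (_ + (_ + _)).
Qed.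

Lemma iter_der_eq0 m n p : (m <= n)%N -> iter m D p = 0 -> iter n D p = 0.
Proof. by move=> /subnK <- e; rewrite iterD e iter_der0. Qed.

(** Pigeonhole: in every Leibniz term one of the two factors is differentiated often enough to
    vanish. *)
Lemma iter_derM_eq0 m n p q : iter m D p = 0 -> iter n D q = 0 ->
  iter (m + n).-1 D (p * q) = 0.
Proof.
move=> p0 q0; rewrite iter_derM big1 // => i _.
case: (leqP m i) => mi; first by rewrite (iter_der_eq0 mi p0) mul0r mul0rn.
by rewrite (@iter_der_eq0 n (_ - i) q) // ?mulr0 ?mul0rn //; lia.
Qed.

Definition locally_nilpotent := forall p, exists n, iter n D p = 0.

Lemma locally_nilpotent_gens :
  (exists n, iter n D (mX K) = 0) -> (exists n, iter n D (mY K) = 0) ->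
  locally_nilpotent.
Proof.
move=> nX nY; apply: mpoly2_ind => // [c|p q [m ep] [n eq]|p q [m ep] [n eq]].
- by exists 1%N; rewrite /= derC.
- exists (maxn m n); rewrite iter_derD.
  by rewrite (iter_der_eq0 (leq_maxl m n) ep) (iter_der_eq0 (leq_maxr m n) eq) addr0.
- by exists (m + n).-1; apply: iter_derM_eq0.
Qed.

Hypothesis char0 : [pchar K] =i pred0.
Hypothesis LN : locally_nilpotent.

Lemma LN_eq p : exists n, iter n D p == 0.
Proof. by have [n /eqP] := LN p; exists n. Qed.

(* One more than the usual degree of a locally nilpotent derivation, with
   [nu 0 = 0]. *)
Definition nu p := ex_minn (LN_eq p).

Lemma nuP p n : (nu p <= n)%N = (iter n D p == 0).
Proof.
rewrite /nu; case: ex_minnP => m /eqP e0 min; apply/idP/idP; last exact: min.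
by move=> mn; rewrite (iter_der_eq0 mn e0).
Qed.

Lemma nu_eq0 p : (nu p == 0%N) = (p == 0).
Proof. by rewrite -leqn0 nuP. Qed.

Lemma nu_gt0 p : (0 < nu p)%N = (p != 0).
Proof. by rewrite lt0n nu_eq0. Qed.

Lemma nuD_le p q : (nu (p + q) <= maxn (nu p) (nu q))%N.
Proof.
rewrite nuP iter_derD; have := leq_maxl (nu p) (nu q); rewrite nuP => /eqP ->.
by have := leq_maxr (nu p) (nu q); rewrite nuP => /eqP ->; rewrite addr0.
Qed.

Lemma nuZ c p : c != 0 -> nu (c *: p) = nu p.
Proof.
move=> c0; apply/eqP; rewrite eqn_leq !nuP iter_derZ.
have := leqnn (nu p); rewrite nuP => /eqP ->; rewrite scaler0 eqxx /=.
have := leqnn (nu (c *: p)); rewrite nuP iter_derZ scaler_eq0 (negPf c0).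
by [].
Qed.

Lemma nuN p : nu (- p) = nu p.
Proof. by rewrite -scaleN1r nuZ // oppr_eq0 oner_eq0. Qed.

Lemma nu_der p : nu (D p) = (nu p).-1.
Proof.
apply/eqP; rewrite eqn_leq; apply/andP; split.
  rewrite nuP -iterSr; have := leqSpred (nu p); rewrite nuP; exact.
have : (nu p <= (nu (D p)).+1)%N by rewrite nuP iterSr -nuP.
lia.
Qed.

(** With m and n the true degrees, only the term i = m survives in the Leibniz expansion of the (m +
    n)-th iterate, and characteristic zero keeps its binomial coefficient nonzero. The successor
    comes from [nu] being one more than the degree. *)
Lemma nuM p q : p != 0 -> q != 0 -> (nu (p * q)).+1 = (nu p + nu q)%N.
Proof.
rewrite -!nu_gt0 => p0 q0; set m := (nu p).-1; set n := (nu q).-1.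
have ep : nu p = m.+1 by rewrite prednK.
have eq : nu q = n.+1 by rewrite prednK.
have zp : iter (nu p) D p = 0 by apply/eqP; rewrite -nuP.
have zq : iter (nu q) D q = 0 by apply/eqP; rewrite -nuP.
suff : nu (p * q) = (m + n).+1 by rewrite ep eq; lia.
apply/eqP; rewrite eqn_leq; apply/andP; split.
  rewrite nuP; have -> : (m + n).+1 = (nu p + nu q).-1 by lia.
  by rewrite iter_derM_eq0.
rewrite ltnNge nuP iter_derM.
have mlt : (m < (m + n).+1)%N by lia.
rewrite (bigD1 (Ordinal mlt)) //= big1 ?addr0 => [|i]; last first.
  rewrite -val_eqE /= => im; case: (ltngtP i m) im => // im _.
    by rewrite (@iter_der_eq0 (nu q) _ q) ?mulr0 ?mul0rn //; lia.
  by rewrite (@iter_der_eq0 (nu p) i p) ?mul0r ?mul0rn //; lia.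
have -> : (m + n - m)%N = n by lia.
rewrite -scaler_nat scaler_eq0 negb_or mulf_eq0 negb_or.
rewrite -!nuP -!ltnNge ep eq !ltnSn !andbT.
by move/pcharf0P: char0 => ->; rewrite -lt0n bin_gt0 leq_addr.
Qed.

Lemma nuXn p n : p != 0 -> (nu (p ^+ n)).-1 = (n * (nu p).-1)%N.
Proof.
move=> p0; elim: n => [|n IH].
  rewrite expr0 mul0n -subn1; apply/eqP; rewrite subn_eq0 nuP /=.
  by rewrite -mpolyC1 derC.
have := nuM p0 (expf_neq0 n p0); rewrite -exprS.
rewrite mulSn -{}IH; move: p0 (expf_neq0 n p0); rewrite -!nu_gt0.
by move: (nu (p ^+ n.+1)) (nu (p ^+ n)) (nu p) => a b c; lia.
Qed.
End LocallyNilpotent.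

(** The bounds [m] and [n] are formal degrees: the coefficients there may vanish, so the rule
    survives cancellation of leading terms. *)
Lemma coef_top_mul (R : comNzRingType) (p q : {poly R}) m n :
  (size p <= m.+1)%N -> (size q <= n.+1)%N ->
  (size (p * q)%R <= (m + n).+1)%N /\ (p * q)`_(m + n) = p`_m * q`_n.
Proof.
move=> sp sq; split; first by have := size_polyMleq p q; lia.
have mlt : (m < (m + n).+1)%N by lia.
rewrite coefM (bigD1 (Ordinal mlt)) //= big1 ?addr0 => [|i].
  by congr (_ * q`_(_)); lia.
rewrite -val_eqE /= => im; case: (ltngtP i m) im => // im _.
  by rewrite [q`_ _]nth_default ?mulr0 //; apply: leq_trans sq _; lia.
by rewrite [p`_ _]nth_default ?mul0r //; apply: leq_trans sp _; lia.
Qed.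

(* Proved over an abstract ring, where [ring] is much faster than in
   [{poly {mpoly K[2]}}]. *)
Lemma jac_shift (R : comNzRingType) (s a b p q p' q' : R) :
  s * (a * b) * (p * q - p' * q') = s * a * p * (b * q) - s * b * p' * (a * q').
Proof. ring. Qed.

(** * Jacobian derivations and weighted top forms *)

Section Weights.
Variable K : fieldType.
Local Notation T := {mpoly K[2]}.
Implicit Types (p q f g h : T).
Local Notation X := (mX K).
Local Notation Y := (mY K).

(** Modulo the ideal (x - f, y - g) the substitution is the identity. With f = 0 and g = y this is
    divisibility by x of a polynomial vanishing on x = 0; with an automorphism it yields the fixed
    point ideal. *)
Lemma sub_diff f g p : exists r s, p - sub f g p = r * (X - f) + s * (Y - g).
Proof.
move: p; apply: mpoly2_ind => [c|||p q [r [s e]] [r' [s' e']]|p q [r [s e]] [r' [s' e']]].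
- by exists 0, 0; rewrite subC; ring.
- by exists 1, 0; rewrite subX; ring.
- by exists 0, 1; rewrite subY; ring.
- exists (r + r'), (s + s'); rewrite rmorphD /= mulrDl mulrDl addrACA -e -e'; ring.
- exists (r * q + sub f g p * r'), (s * q + sub f g p * s'); rewrite rmorphM /=.
  transitivity ((p - sub f g p) * q + sub f g p * (q - sub f g q)); first by ring.
  by rewrite e e'; ring.
Qed.

Definition jac p q := dx p * dy q - dy p * dx q.

Lemma is_der_jac f : is_derivation (jac^~ f).
Proof.
split=> [c p q|p q]; rewrite /jac.
  by rewrite !linearP /= -!mul_mpolyC; ring.
by rewrite dxM dyM; ring.
Qed.

Lemma jac_sub f g p q : jac (sub f g p) (sub f g q) = sub f g (jac p q) * jac f g.
Proof.
by rewrite /jac !dx_sub !dy_sub rmorphB !rmorphM /=; ring.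
Qed.

Lemma jacXl f : jac X f = dy f.
Proof. by rewrite /jac dxX dyX; ring. Qed.
Lemma jacYl f : jac Y f = - dx f.
Proof. by rewrite /jac dxY dyY; ring. Qed.
Lemma jac_self f : jac f f = 0.
Proof. by rewrite /jac; ring. Qed.

(** By the chain rule for [rho] and its inverse the Jacobian divides 1, so it is a unit. *)
Lemma jac_aut rho : is_Kalg_automorphism rho ->
  exists2 c, c != 0 & jac (rho X) (rho Y) = c%:MP.
Proof.
move=> arho; have [rho' [arho' c1 c2]] := aut_inv arho.
have : jac (rho (rho' X)) (rho (rho' Y)) = 1.
  by rewrite !c2 /jac dxX dyY dxY dyX; ring.
rewrite (autE arho (rho' X)) (autE arho (rho' Y)) jac_sub => /mpoly_intro_unit /andP[/eqP e u].
exists (jac (rho X) (rho Y))@_0 => //.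
by rewrite unitfE in u.
Qed.

Lemma iter_dx_LN : locally_nilpotent (@dx K).
Proof.
apply: locally_nilpotent_gens; first exact: is_der_dx.
  by exists 2%N; rewrite /= dxX -mpolyC1 dxC.
by exists 1%N; rewrite /= dxY.
Qed.

(** Up to the constant Jacobian, [rho] conjugates d/dx into this derivation. *)
Lemma jac_aut_LN rho : is_Kalg_automorphism rho ->
  locally_nilpotent (jac^~ (rho Y)).
Proof.
move=> arho p; have [rho' [arho' c1 c2]] := aut_inv arho.
have [c c0 ec] := jac_aut arho; have [n en] := iter_dx_LN (rho' p).
exists n.
have rhoZ d q : rho (d *: q) = d *: rho q.
  by rewrite (autE arho (d *: q)) linearZ /= -(autE arho q).
have iterE m q : iter m (jac^~ (rho Y)) (rho q) = c ^+ m *: rho (iter m (@dx K) q).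
  elim: m q => [|m IH] q; first by rewrite expr0 scale1r.
  rewrite iterSr iterSr.
  have -> : jac (rho q) (rho Y) = rho (c *: dx q).
    have := jac_sub (rho X) (rho Y) q Y; rewrite subY -(autE arho q) ec => ->.
    rewrite -(autE arho) rhoZ mulrC mul_mpolyC.
    by rewrite /jac dxY dyY mulr1 mulr0 subr0.
  by rewrite IH (iter_derZ (is_der_dx K)) rhoZ scalerA -exprSr.
by rewrite -(c2 p) iterE en (autE arho 0) rmorph0 scaler0.
Qed.

Definition wt (a b : nat) (m : 'X_{1..2}) := (a * m ord0 + b * m ord_max)%N.

Section Phi.
Variables a b : nat.

Definition phi_gen (i : 'I_2) : {poly T} :=
  if i == ord0 then X%:P * 'X^a else Y%:P * 'X^b.
(** This is p(x t^a, y t^b) as a polynomial in t: the coefficient of t^d is the component of [p] of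
    weighted degree d, and the size bounds the weighted degree. *)
Definition phi (p : T) : {poly T} :=
  mmap (polyC \o @mpolyC 2 K) phi_gen p.
HB.instance Definition _ := GRing.RMorphism.copy phi
  (mmap (polyC \o @mpolyC 2 K) phi_gen).

Lemma phiC c : phi c%:MP = c%:MP%:P.
Proof. by rewrite /phi mmapC. Qed.
Lemma phiX : phi X = X%:P * 'X^a.
Proof. by rewrite /phi mmapX mmap1U. Qed.
Lemma phiY : phi Y = Y%:P * 'X^b.
Proof. by rewrite /phi mmapX mmap1U. Qed.

Lemma phi_mon m : phi 'X_[m] = 'X_[m]%:P * 'X^(wt a b m).
Proof.
rewrite mpolyX2 rmorphM !rmorphXn /= phiX phiY !exprMn -!exprM -!polyC_exp polyCM.
by rewrite /wt exprD mulrACA.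
Qed.

Lemma phi_coef p d m : ((phi p)`_d)@_m = if wt a b m == d then p@_m else 0.
Proof.
rewrite {1}[p]mpolyE rmorph_sum coef_sum /= raddf_sum /=.
transitivity (\sum_(m' <- msupp p) (if wt a b m == d then p@_m' * (m' == m)%:R else 0)).
  apply: eq_bigr => m' _.
  rewrite -mul_mpolyC rmorphM /= phi_mon phiC mulrA -polyCM coefCM coefXn.
  rewrite mul_mpolyC; have [e|ne] := eqVneq m' m.
    rewrite e eq_sym; case: eqP => _; rewrite ?mulr1 ?mulr0 ?mcoeff0 //.
    by rewrite mcoeffZ mcoeffX eqxx mulr1.
  rewrite mulr0 if_same; case: eqP => _; rewrite ?mulr1 ?mulr0 ?mcoeff0 //.
  by rewrite mcoeffZ mcoeffX (negPf ne) mulr0.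
case: eqP => _; last by rewrite big1.
by rewrite [in RHS](mpolyE p) raddf_sum /=; apply: eq_bigr => i _; rewrite mcoeffZ mcoeffX.
Qed.

Lemma size_phi_le p d :
  (forall m, m \in msupp p -> (wt a b m <= d)%N) -> (size (phi p) <= d.+1)%N.
Proof.
move=> H; apply/leq_sizeP => j dj; apply/mpolyP => m; rewrite phi_coef mcoeff0.
case: eqP => // e; apply/eqP; rewrite mcoeff_eq0; apply/negP => /H; lia.
Qed.

Lemma size_phi_leP p d m :
  (size (phi p) <= d.+1)%N -> m \in msupp p -> (wt a b m <= d)%N.
Proof.
move=> sz; rewrite mcoeff_msupp leqNgt; apply: contra => lt.
by have := phi_coef p (wt a b m) m; rewrite eqxx => <-; rewrite nth_default ?mcoeff0 //; exact: leq_trans sz lt.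
Qed.

Lemma map_dx_phi p : map_poly (@dx K) (phi p) = 'X^a * phi (dx p).
Proof.
apply/polyP => d; rewrite coef_map coefXnM /=; apply/mpolyP => m.
rewrite mcoeff_deriv phi_coef /wt mnmDE mnmDE !mnm1E /=.
case: ltnP => ad.
  rewrite mcoeff0; case: eqP => e; last by rewrite mul0rn.
  by exfalso; nia.
rewrite phi_coef mcoeff_deriv /wt.
have -> : (a * (m ord0 + (ord0 == ord0 :> 'I_2)) + b * (m ord_max + 0) == d)%N =
          (a * m ord0 + b * m ord_max == d - a)%N by rewrite eqxx; apply/eqP/eqP; nia.
by case: eqP => _; rewrite ?mul0rn.
Qed.

Lemma map_dy_phi p : map_poly (@dy K) (phi p) = 'X^b * phi (dy p).
Proof.
apply/polyP => d; rewrite coef_map coefXnM /=; apply/mpolyP => m.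
rewrite mcoeff_deriv phi_coef /wt mnmDE mnmDE !mnm1E /=.
case: ltnP => ad.
  rewrite mcoeff0; case: eqP => e; last by rewrite mul0rn.
  by exfalso; nia.
rewrite phi_coef mcoeff_deriv /wt.
have -> : (a * (m ord0 + 0) + b * (m ord_max + (ord_max == ord_max :> 'I_2)) == d)%N =
          (a * m ord0 + b * m ord_max == d - b)%N by rewrite eqxx; apply/eqP/eqP; nia.
by case: eqP => _; rewrite ?mul0rn.
Qed.

(** Taking a Jacobian lowers weighted degrees by a + b. The factor ['X^s] stores what earlier
    Jacobians have lost, so top weights simply add and no subtraction of naturals occurs. *)
Lemma phi_jac_top f N p s e : (size (phi f) <= N.+1)%N ->
  (size ('X^s * phi p)%R <= e.+1)%N ->
  let E q := jac q ((phi f)`_N) in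
  (size ('X^(s + (a + b)) * phi (jac p f))%R <= (e + N).+1)%N /\
  ('X^(s + (a + b)) * phi (jac p f))`_(e + N) = E (('X^s * phi p)`_e).
Proof.
move=> sf sp E.
have hX : map_poly (@dx K) ('X^s * phi p) = 'X^(s + a) * phi (dx p).
  rewrite exprD -mulrA -map_dx_phi; apply/polyP => i.
  by rewrite coef_map !coefXnM /=; case: ifP; rewrite ?raddf0 // coef_map.
have hY : map_poly (@dy K) ('X^s * phi p) = 'X^(s + b) * phi (dy p).
  rewrite exprD -mulrA -map_dy_phi; apply/polyP => i.
  by rewrite coef_map !coefXnM /=; case: ifP; rewrite ?raddf0 // coef_map.
have eJ : 'X^(s + (a + b)) * phi (jac p f) =
   map_poly (@dx K) ('X^s * phi p) * map_poly (@dy K) (phi f) -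
   map_poly (@dy K) ('X^s * phi p) * map_poly (@dx K) (phi f).
  rewrite hX hY map_dx_phi map_dy_phi /jac rmorphB !rmorphM /= !exprD.
  exact: jac_shift.
have szm (F : {additive T -> T}) (u : {poly T}) k : (size u <= k.+1)%N -> (size (map_poly F u) <= k.+1)%N.
  by move=> h; apply: leq_trans (size_poly _ _) h.
have [s1 c1] := coef_top_mul (szm (@dx K) _ _ sp) (szm (@dy K) _ _ sf).
have [s2 c2] := coef_top_mul (szm (@dy K) _ _ sp) (szm (@dx K) _ _ sf).
rewrite eJ; split.
  by apply: leq_trans (size_polyD _ _) _; rewrite size_polyN geq_max s1 s2.
by rewrite coefB c1 c2 !coef_map.
Qed.

Lemma iter_jac_top f N p e n : (size (phi f) <= N.+1)%N ->
  (size (phi p) <= e.+1)%N -> iter n (jac^~ f) p = 0 ->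
  iter n (jac^~ ((phi f)`_N)) ((phi p)`_e) = 0.
Proof.
move=> sf sp ez.
suff [_ <-] : (size ('X^(n * (a + b)) * phi (iter n (jac^~ f) p))%R <= (e + n * N).+1)%N /\
   ('X^(n * (a + b)) * phi (iter n (jac^~ f) p))`_(e + n * N) =
   iter n (jac^~ ((phi f)`_N)) ((phi p)`_e) by rewrite ez rmorph0 mulr0 coef0.
elim: n {ez} => [|n [IH1 IH2]]; first by rewrite !mul0n expr0 mul1r addn0.
have [h1 h2] := phi_jac_top sf IH1.
rewrite !mulSnr [(e + (_ + N))%N]addnA [iter n.+1 _ _]iterS [iter n.+1 _ ((phi p)`_e)]iterS.
by rewrite h2 IH2.
Qed.

(** Nilpotency need only be tested on x and y, which are their own top forms. *)
Lemma top_LN f N : (size (phi f) <= N.+1)%N -> locally_nilpotent (jac^~ f) ->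
  locally_nilpotent (jac^~ ((phi f)`_N)).
Proof.
move=> sf LN; apply: locally_nilpotent_gens; first exact: is_der_jac.
  have [n en] := LN X; exists n.
  have := @iter_jac_top f N X a n sf _ en; rewrite phiX coefCM coefXn eqxx mulr1.
  by apply; rewrite mul_polyC; apply: leq_trans (size_scale_leq _ _) _; rewrite size_polyXn.
have [n en] := LN Y; exists n.
have := @iter_jac_top f N Y b n sf _ en; rewrite phiY coefCM coefXn eqxx mulr1.
by apply; rewrite mul_polyC; apply: leq_trans (size_scale_leq _ _) _; rewrite size_polyXn.
Qed.
End Phi.
End Weights.
Arguments jac {K} p q.

(** * Supports, monomials and partial derivatives *)

Section Monomials.
Variable K : fieldType.
Local Notation T := {mpoly K[2]}.
Implicit Types (p q f g h : T).
Local Notation X := (mX K).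
Local Notation Y := (mY K).

Lemma mnm2P (m m' : 'X_{1..2}) :
  m ord0 = m' ord0 -> m ord_max = m' ord_max -> m = m'.
Proof. by move=> e0 e1; apply/mnmP => i; case: (ord2P i) => ->. Qed.

Lemma mdeg2 (m : 'X_{1..2}) : mdeg m = (m ord0 + m ord_max)%N.
Proof.
rewrite mdegE 2!big_ord_recl big_ord0 addn0.
by congr (_ + m _)%N; apply: val_inj.
Qed.

Lemma mnmX_comp (i : 'I_2) n j : (U_(i) *+ n)%MM j = (if i == j then n else 0%N).
Proof. by rewrite mulmnE mnm1E; case: eqP; rewrite ?mul1n ?mul0n. Qed.

Lemma msupp_dx p : dx p != 0 -> exists2 m, m \in msupp p & (0 < m ord0)%N.
Proof.
rewrite -msupp_eq0; case e : (msupp (dx p)) => [//|m s] _.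
have : m \in msupp (dx p) by rewrite e mem_head.
rewrite mcoeff_msupp mcoeff_deriv => h.
exists (m + U_(ord0))%MM; last by rewrite mnmDE mnm1E eqxx addn1.
by rewrite mcoeff_msupp; apply: contraNneq h => ->; rewrite mul0rn.
Qed.

Lemma sub0_msupp p : sub 0 Y p != 0 -> exists2 m, m \in msupp p & m ord0 = 0%N.
Proof.
move=> h; suff /hasP[m mp /eqP e] : has (fun m : 'X_{1..2} => m ord0 == 0%N) (msupp p).
  by exists m.
apply: contraNT h => /hasPn h; apply/eqP.
rewrite [p]mpolyE rmorph_sum /= big_seq big1 // => m /h m0.
rewrite linearZ /= mpolyX2 rmorphM !rmorphXn /= subX.
by rewrite expr0n (negPf m0) mul0r scaler0.
Qed.

Lemma msize_le p n : (forall m, m \in msupp p -> (mdeg m < n)%N) -> (msize p <= n)%N.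
Proof. by move=> h; rewrite msizeE; apply/bigmax_leqP_seq => m mp _; apply: h. Qed.

Lemma mpoly1_msupp p m0 : (forall m, m \in msupp p -> m = m0) -> p = p@_m0 *: 'X_[m0].
Proof.
move=> h; apply/mpolyP => m; rewrite mcoeffZ mcoeffX.
have [<-|ne] := eqVneq m0 m; first by rewrite mulr1.
rewrite mulr0; apply/eqP; rewrite mcoeff_eq0; apply/negP => /h e.
by rewrite e eqxx in ne.
Qed.

Lemma mpoly_deg1 p : (deg p <= 1)%N ->
  p = p@_(U_(ord0)) *: X + p@_(U_(ord_max)) *: Y + (p@_0)%:MP.
Proof.
move=> d1; apply/mpolyP => m; rewrite !mcoeffD !mcoeffZ mcoeffC !mcoeffX.
case: (posnP (mdeg m)) => [|m0].
  move/eqP; rewrite mdeg_eq0 => /eqP ->.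
  by rewrite eqxx !mnm1_eq0 !mulr0 !add0r mulr1.
case: (ltnP 1 (mdeg m)) => m1.
  have -> : p@_m = 0.
    by apply/eqP; rewrite mcoeff_eq0; apply: msize_mdeg_ge; rewrite /deg in d1; lia.
  have ne m' : (mdeg m' <= 1)%N -> (m' == m) = false by move=> h; apply/eqP => e; move: m1; rewrite -e; lia.
  by rewrite !ne ?mdeg1 // [m == _]eq_sym ne ?mdeg0 // !mulr0 !addr0.
have {m0 m1} : (m ord0 + m ord_max)%N = 1%N by rewrite -mdeg2; lia.
case e0: (m ord0) => [|[|//]] e1.
  have -> : m = U_(ord_max)%MM by apply: mnm2P; rewrite mnm1E /= ?e0 //; lia.
  rewrite eqxx mnm1_eq0 !mulr0 addr0 mulr1.
  by rewrite (_ : U_(ord0)%MM == U_(ord_max)%MM = false) ?mulr0 ?add0r //;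
    apply/eqP => /mnmP /(_ ord0); rewrite !mnm1E.
have -> : m = U_(ord0)%MM by apply: mnm2P; rewrite mnm1E /= ?e0 //; lia.
rewrite eqxx mnm1_eq0 !mulr0 addr0 mulr1.
by rewrite (_ : U_(ord_max)%MM == U_(ord0)%MM = false) ?mulr0 ?addr0 //;
    apply/eqP => /mnmP /(_ ord0); rewrite !mnm1E.
Qed.

Hypothesis char0 : [pchar K] =i pred0.

Lemma mulrn_neq0 (c : K) n : c != 0 -> (0 < n)%N -> c *+ n != 0.
Proof.
move=> c0 n0; rewrite -mulr_natr mulf_neq0 //.
by move/pcharf0P: char0 => ->; rewrite -lt0n.
Qed.

Lemma deriv_msupp i p m : m \in msupp p -> (0 < m i)%N -> (p^`M(i))@_(m - U_(i)) != 0.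
Proof.
rewrite mcoeff_msupp mcoeff_deriv => h mi.
rewrite submK; last by rewrite lep1mP -lt0n.
exact: mulrn_neq0.
Qed.

Lemma deriv_eq0 i p : p^`M(i) = 0 -> forall m, m \in msupp p -> m i = 0%N.
Proof.
move=> e m mp; case: (posnP (m i)) => // mi.
by have := deriv_msupp mp mi; rewrite e mcoeff0 eqxx.
Qed.

Lemma dx_eq0_ev p : dx p = 0 -> exists P, p = ev P Y.
Proof.
move/deriv_eq0 => h; exists (\sum_(m <- msupp p) p@_m *: 'X^(m ord_max)).
rewrite {1}[p]mpolyE /ev rmorph_sum /= big_seq [in RHS]big_seq; apply: eq_bigr => m mp.
by rewrite -/(ev _ _) evZ evXn mpolyX2 h // expr0 mul1r.
Qed.

Lemma dy_eq0_ev p : dy p = 0 -> exists P, p = ev P X.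
Proof.
move/deriv_eq0 => h; exists (\sum_(m <- msupp p) p@_m *: 'X^(m ord0)).
rewrite {1}[p]mpolyE /ev rmorph_sum /= big_seq [in RHS]big_seq; apply: eq_bigr => m mp.
by rewrite -/(ev _ _) evZ evXn mpolyX2 h // expr0 mulr1.
Qed.
End Monomials.

(** * The slope of the Newton polygon at the vertex y^n *)

Section Slope.
Variable K : fieldType.
Hypothesis char0 : [pchar K] =i pred0.
Local Notation T := {mpoly K[2]}.
Implicit Types (p q f g h : T).
Local Notation X := (mX K).
Local Notation Y := (mY K).

(** Ratios are compared by cross multiplication; the minimizer selects an edge of a Newton
    polygon. *)
Lemma min_ratio (A : eqType) (num den : A -> nat) (s : seq A) :
  (forall x, x \in s -> 0 < den x)%N -> s != [::] ->
  exists2 x, x \in s & forall y, y \in s -> (num x * den y <= num y * den x)%N.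
Proof.
elim: s => [//|x s IH] d0 _; have [->|s0] := eqVneq s [::].
  by exists x; rewrite ?mem_head // => y; rewrite inE => /eqP ->.
have [|//|z zs zmin] := IH; first by move=> y ys; apply: d0; rewrite inE ys orbT.
have dz : (0 < den z)%N by apply: d0; rewrite inE zs orbT.
have dx : (0 < den x)%N by apply: d0; rewrite mem_head.
case: (leqP (num x * den z) (num z * den x)) => c.
  exists x; rewrite ?mem_head // => y; rewrite inE => /orP[/eqP -> //|ys].
  rewrite -(leq_pmul2r dz) mulnAC.
  apply: leq_trans (leq_mul c (leqnn (den y))) _.
  by rewrite mulnAC [leqRHS]mulnAC leq_mul2r zmin ?orbT.
exists z; first by rewrite inE zs orbT.
move=> y; rewrite inE => /orP[/eqP ->|]; last exact: zmin.
exact: ltnW.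
Qed.

(** Two linear equations with nonzero determinant have at most one solution. *)
Lemma two_weights (a b al be i j i' j' N M : nat) : (a * be <> b * al)%N ->
  (a * i + b * j = N)%N -> (a * i' + b * j' = N)%N ->
  (i * al + j * be = M)%N -> (i' * al + j' * be = M)%N -> i = i' /\ j = j'.
Proof.
move=> ne w w' v v'.
have cancel x x' (A B : nat) : A <> B -> (x * A + x' * B = x' * A + x * B)%N -> x = x'.
  by move=> AB e; case: (ltngtP x x') => // lt; exfalso; nia.
split; [apply: cancel ne _ | apply: (cancel _ _ _ _ (nesym ne))]; rewrite -{}v in v'; rewrite -{}w in w'.
  have e1 : (be * (a * i' + b * j') = be * (a * i + b * j))%N by rewrite w'.
  have e2 : (b * (i' * al + j' * be) = b * (i * al + j * be))%N by rewrite v'.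
  lia.
have e1 : (al * (a * i' + b * j') = al * (a * i + b * j))%N by rewrite w'.
have e2 : (a * (i' * al + j' * be) = a * (i * al + j * be))%N by rewrite v'.
lia.
Qed.


Lemma nu_mon (D : T -> T) (dD : is_derivation D) (LN : locally_nilpotent D) (m : 'X_{1..2}) :
  nu LN 'X_[m] = (m ord0 * (nu LN X).-1 + m ord_max * (nu LN Y).-1).+1.
Proof.
have X0 : X != 0 by apply: deg_gt0_neq0; rewrite degX.
have Y0 : Y != 0 by apply: deg_gt0_neq0; rewrite degY.
have g1 : (0 < nu LN (X ^+ m ord0))%N by rewrite nu_gt0 // expf_neq0.
have g2 : (0 < nu LN (Y ^+ m ord_max))%N by rewrite nu_gt0 // expf_neq0.
rewrite mpolyX2 -!nuXn //.
have := nuM dD char0 LN (expf_neq0 (m ord0) X0) (expf_neq0 (m ord_max) Y0).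
move: g1 g2; clear; move: (nu _ (X ^+ _)) (nu _ (Y ^+ _)) (nu _ (_ * _)) => A B C.
by lia.
Qed.

(** The form [F] lies in the kernel of its own Jacobian derivation, which forces the degrees of x
    and y for this derivation to be in the ratio a : b, so x has the larger one. But [dx F] is, up
    to sign, the derivative of y; having smaller degree than y, it cannot be divisible by x. *)
Lemma edge_linear_term (F : T) a b N mx my :
  (0 < b < a)%N -> locally_nilpotent (jac^~ F) ->
  (forall m, m \in msupp F -> wt a b m = N) ->
  mx \in msupp F -> (0 < mx ord0)%N ->
  my \in msupp F -> my ord0 = 0%N -> (0 < my ord_max)%N ->
  exists2 m, m \in msupp F & m ord0 = 1%N.
Proof.
move=> /andP[b0 ltab] LNF wF mxF mx0 myF my0 my1.
have dF := is_der_jac F.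
have dxF : dx F != 0.
  by apply: contraTneq mxF => e; apply/negP => /(deriv_eq0 char0 e) e0; rewrite e0 in mx0.
have X0 : X != 0 by apply: deg_gt0_neq0; rewrite degX.
have vF : (nu LNF F <= 1)%N by rewrite (nuP dF) /= jac_self.
have vX0 : (0 < nu LNF X)%N by rewrite (nu_gt0 dF).
have vY1 : (1 < nu LNF Y)%N by rewrite ltnNge (nuP dF) /= jacYl oppr_eq0.
(* Otherwise the monomials of [F] have distinct [nu], so the pure power of y has [nu] at most
   [nu F], hence at most 1, although y is not in the kernel. *)
have eab : (a * (nu LNF Y).-1 = b * (nu LNF X).-1)%N.
  apply/eqP; apply: contraT => /eqP ne; exfalso.
  have U : uniq [seq nu LNF (F@_m *: 'X_[m]) | m <- msupp F].
    rewrite map_inj_in_uniq ?msupp_uniq // => m m' mF mF'.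
    move: (mF) (mF'); rewrite !mcoeff_msupp => n0 n0'.
    rewrite !(nuZ dF) // (nu_mon dF LNF m) (nu_mon dF LNF m') => -[e].
    by have [] := two_weights ne (wF m mF) (wF m' mF') e (erefl _); exact: mnm2P.
  have v0 : nu LNF 0 = 0%N by apply/eqP; rewrite (nu_eq0 dF).
  have le := val_sum_distinct v0 (nuN dF LNF) (nuD_le dF LNF) U myF.
  move: myF; rewrite mcoeff_msupp => c0.
  rewrite -mpolyE (nuZ dF) // (nu_mon dF) my0 in le.
  by move: (leq_trans le vF) my1 vY1; clear; nia.
have lt_vY_vX : (nu LNF Y < nu LNF X)%N.
  by move: ltab b0 eab vY1 vX0; clear; move: (nu LNF X) (nu LNF Y) => x y; nia.
have vdx : nu LNF (dx F) = (nu LNF Y).-1.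
  by have := nu_der dF LNF Y; rewrite jacYl (nuN dF).
suff /hasP[m mF /eqP e] : has (fun m : 'X_{1..2} => m ord0 == 1%N) (msupp F) by exists m.
apply: contraT => /hasPn hn; exfalso.
(* Without a monomial linear in x, every monomial of [dx F] contains x. *)
have sz : sub 0 Y (dx F) = 0.
  apply/eqP; apply: contraT => /sub0_msupp [m].
  rewrite mcoeff_msupp mcoeff_deriv => h m0.
  have mm : (m + U_(ord0))%MM \in msupp F.
    by rewrite mcoeff_msupp; apply: contraNneq h => ->; rewrite mul0rn.
  by have := hn _ mm; rewrite mnmDE mnm1E m0.
have [r [s]] := sub_diff 0 Y (dx F); rewrite sz subrr mulr0 addr0 !subr0 => e.
have r0 : r != 0 by apply: contraNneq dxF => r0; rewrite e r0 mul0r.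
have := nuM dF char0 LNF r0 X0; rewrite -e vdx.
have : (0 < nu LNF r)%N by rewrite (nu_gt0 dF).
by move: lt_vY_vX vY1; clear; lia.
Qed.

(** The edge leaving the vertex y^n has some weights (a, b) with a > b, and its form again has a
    locally nilpotent Jacobian derivation. A monomial linear in x on this edge forces b to divide a,
    so the weights may be taken as (k, 1). *)
Lemma edge_slope f n :
  locally_nilpotent (jac^~ f) -> (U_(ord_max) *+ n)%MM \in msupp f ->
  (forall m, m \in msupp f -> m <> (U_(ord_max) *+ n)%MM -> (mdeg m < n)%N) ->
  dx f != 0 -> exists k, [/\ (2 <= k)%N,
    forall m, m \in msupp f -> (k * m ord0 + m ord_max <= n)%N &
    exists2 m, m \in msupp f & m ord0 = 1%N /\ (k + m ord_max)%N = n].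
Proof.
move=> LN Un small dxf.
have [m1 m1f m10] := msupp_dx dxf.
have lt_n m : m \in msupp f -> (0 < m ord0)%N -> (m ord0 + m ord_max < n)%N.
  by move=> mf m0; rewrite -mdeg2; apply: small => // e; rewrite e mnmX_comp in m0.
(* The edge minimizes (n - j) / i over the monomials x^i y^j with i > 0; a = n - j and b = i are
   read off a minimizer. *)
have [||ms] := @min_ratio _ (fun m : 'X_{1..2} => n - m ord_max)%N
   (fun m : 'X_{1..2} => m ord0) [seq m : 'X_{1..2} <- msupp f | (0 < m ord0)%N].
- by move=> m; rewrite mem_filter => /andP[].
- by apply/eqP => e; have := in_nil m1; rewrite -e mem_filter m10 m1f.
rewrite mem_filter => /andP[ms0 msf] msmin.
have ltn_ms := lt_n ms msf ms0.
have [a ea] : exists a, (a + ms ord_max = n)%N.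
  by exists (n - ms ord_max)%N; move: ltn_ms; clear; lia.
have [b eb] : exists b, b = ms ord0 by exists (ms ord0).
rewrite -eb in ms0 msmin ltn_ms.
have {msmin} msmin m : m \in msupp f -> (0 < m ord0)%N -> (a * m ord0 <= (n - m ord_max) * b)%N.
  move=> mf m0; have := msmin m; rewrite mem_filter m0 mf => /(_ isT).
  by rewrite -ea addnK.
have ltab : (b < a)%N by move: ltn_ms; rewrite -ea; clear; lia.
have wle m : m \in msupp f -> (wt a b m <= b * n)%N.
  move=> mf; rewrite /wt; case: (posnP (m ord0)) => m0.
    rewrite m0 muln0 add0n leq_mul2l; apply/orP; right.
    have [->|/eqP ne] := eqVneq m (U_(ord_max) *+ n)%MM; first by rewrite mnmX_comp eqxx.
    by have := small m mf ne; rewrite mdeg2 m0 => /ltnW.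
  have h1 := lt_n m mf m0; have h2 := msmin m mf m0.
  have e : n = (n - m ord_max + m ord_max)%N by move: h1; clear; lia.
  by rewrite {1}e mulnDr [(b * (n - _))%N]mulnC leq_add2r.
have szf : (size (phi a b f) <= (b * n).+1)%N by apply: size_phi_le.
have FS m : (m \in msupp (phi a b f)`_(b * n)) = (wt a b m == b * n)%N && (m \in msupp f).
  by rewrite !mcoeff_msupp phi_coef; case: ifP => //; rewrite eqxx.
have n0 : (0 < n)%N by move: ltn_ms; clear; lia.
have [||m||||||m] := @edge_linear_term (phi a b f)`_(b * n) a b (b * n) ms (U_(ord_max) *+ n)%MM.
- by rewrite ms0 ltab.
- exact: top_LN.
- by rewrite FS => /andP[/eqP].
- by rewrite FS msf andbT /wt -eb -ea; apply/eqP; clear; lia.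
- by rewrite -eb.
- by rewrite FS Un andbT /wt !mnmX_comp /= muln0.
- by rewrite mnmX_comp.
- by rewrite mnmX_comp.
rewrite FS => /andP[/eqP + mf] m0; rewrite /wt m0 muln1 => ew.
have ltm := lt_n m mf; rewrite m0 in ltm; have {}ltm := ltm isT.
have [k ek] : exists k, (k + m ord_max = n)%N.
  by exists (n - m ord_max)%N; move: ltm; clear; lia.
have eak : a = (b * k)%N.
  by move: ew; rewrite -ek mulnDr; clear; lia.
exists k; split.
- by move: ltab; rewrite eak; clear; case: k => [|[|k]] //; rewrite ?muln0 ?muln1 // ltnn.
- by move=> m' /wle; rewrite /wt eak -mulnA -mulnDr leq_pmul2l.
- by exists m.
Qed.
End Slope.

(** * Triangular automorphisms and the swap *)

Section Letters.
Variable K : fieldType.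
Local Notation T := {mpoly K[2]}.
Implicit Types (p q f g h : T) (P Q : {poly K}).
Local Notation X := (mX K).
Local Notation Y := (mY K).

Lemma sub_ext (F G : {lrmorphism T -> T}) : F X = G X -> F Y = G Y -> F =1 G.
Proof. by move=> eX eY p; rewrite lrmorph_sub [RHS]lrmorph_sub eX eY. Qed.

Lemma ev_comp P Q q : ev (P \Po Q) q = ev P (ev Q q).
Proof.
elim/poly_ind: P => [|P c IH]; first by rewrite comp_poly0 !ev0.
by rewrite comp_poly_MXaddC !(evD, evM, evC, evX) IH.
Qed.

(** Data of the triangular map x -> al x + P(y), y -> be y + ga. Keeping the coefficients as data
    lets products and inverses be computed as letters again. *)
Record letter := Letter { l_al : K; l_be : K; l_ga : K; l_P : {poly K} }.

Definition valid l := (l_al l != 0) && (l_be l != 0).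
Definition triX l : T := l_al l *: X + ev (l_P l) Y.
Definition triY l : T := l_be l *: Y + (l_ga l)%:MP.
Definition tri l : T -> T := sub (triX l) (triY l).
HB.instance Definition _ l := GRing.LRMorphism.copy (tri l) (sub (triX l) (triY l)).
Definition swp : T -> T := sub Y X.
HB.instance Definition _ := GRing.LRMorphism.copy swp (sub Y X).

Definition lmul l l' := Letter (l_al l * l_al l') (l_be l * l_be l')
  (l_be l' * l_ga l + l_ga l')
  (l_al l' *: l_P l + (l_P l' \Po (l_be l *: 'X + (l_ga l)%:P))).

Definition linv l := Letter (l_al l)^-1 (l_be l)^-1 (- (l_be l)^-1 * l_ga l)
  (- (l_al l)^-1 *: (l_P l \Po ((l_be l)^-1 *: 'X + (- (l_be l)^-1 * l_ga l)%:P))).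

Definition lid := Letter 1 1 0 0.

Lemma triXE l : tri l X = triX l. Proof. exact: subX. Qed.
Lemma triYE l : tri l Y = triY l. Proof. exact: subY. Qed.
Lemma swpX : swp X = Y. Proof. exact: subX. Qed.
Lemma swpY : swp Y = X. Proof. exact: subY. Qed.
Lemma swpK : involutive swp.
Proof.
by move=> p; rewrite /swp sub_sub subX subY sub_id.
Qed.

Lemma tri_ev l P q : tri l (ev P q) = ev P (tri l q). Proof. exact: sub_ev. Qed.
Lemma tri_lid : tri lid =1 id.
Proof.
move=> p; rewrite /tri /triX /triY /= ev0 !scale1r mpolyC0 !addr0; exact: sub_id.
Qed.

Lemma ev_lin c d q : ev (c *: 'X + d%:P) q = c *: q + d%:MP.
Proof. by rewrite evD evZ evX evC. Qed.

Lemma tri_lmul l l' p : tri l (tri l' p) = tri (lmul l l') p.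
Proof.
apply: (@sub_ext (tri l \o tri l') (tri (lmul l l'))) => /=.
  rewrite !triXE /triX linearD linearZ /= triXE /triX tri_ev triYE /triY /=.
  rewrite evD evZ ev_comp ev_lin scalerDr scalerA [l_al l' * _]mulrC; by rewrite addrA.
rewrite !triYE /triY linearD linearZ /= triYE /triY lrmorphC /=.
by rewrite scalerDr scalerA -addrA -[_ *: _%:MP]mul_mpolyC -mpolyCM -mpolyCD mulrC.
Qed.

Lemma valid_lmul l l' : valid l -> valid l' -> valid (lmul l l').
Proof. by rewrite /valid /= !mulf_eq0 !negb_or => /andP[-> ->] /andP[-> ->]. Qed.

Lemma valid_linv l : valid l -> valid (linv l).
Proof. by rewrite /valid /= !invr_eq0. Qed.

Lemma triK l : valid l -> cancel (tri l) (tri (linv l)).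
Proof.
case: l => al be ga P /andP[/= al0 be0] p.
rewrite tri_lmul /lmul /linv /= -[RHS]tri_lid; congr (tri _ p).
rewrite /lid; congr Letter; rewrite ?mulVf //.
  by rewrite mulrA mulrN mulfV // mulN1r addNr.
by rewrite scalerA mulrN mulfV // scaleN1r addNr.
Qed.

Lemma triVK l : valid l -> cancel (tri (linv l)) (tri l).
Proof.
case: l => al be ga P /andP[/= al0 be0] p.
rewrite tri_lmul /lmul /linv /= -[RHS]tri_lid; congr (tri _ p).
rewrite /lid; congr Letter; rewrite ?mulfV //.
  by rewrite mulNr addrN.
rewrite comp_polyZ -comp_polyA comp_polyD comp_polyZ comp_polyX comp_polyC.
rewrite scalerDr scalerA mulVf // scale1r -addrA.
rewrite -[_ *: ga%:P]mul_polyC -polyCM -polyCD mulNr addrN addr0.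
by rewrite comp_polyXr scaleNr addrN.
Qed.

Lemma aut_tri l : valid l -> is_Kalg_automorphism (tri l).
Proof.
by move=> vl; apply: (@aut_sub _ _ _ (triX (linv l)) (triY (linv l))); [exact: triK|exact: triVK].
Qed.

Lemma aut_swp : is_Kalg_automorphism swp.
Proof. by apply: (@aut_sub _ _ _ Y X); exact: swpK. Qed.

Definition shear s k := Letter 1 1 0 (s *: 'X^k).
Lemma valid_shear s k : valid (shear s k).
Proof. by rewrite /valid /= oner_eq0. Qed.
Lemma tri_shear s k : tri (shear s k) =1 sub (X + s *: Y ^+ k) Y.
Proof.
by move=> p; rewrite /tri /triX /triY /= !scale1r mpolyC0 addr0 evZ evXn.
Qed.
End Letters.

(** * Straightening the weighted top form of a coordinate *)

Section Straighten.
Variable K : closedFieldType.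
Hypothesis char0 : [pchar K] =i pred0.
Local Notation T := {mpoly K[2]}.
Implicit Types (p q f g h : T) (P Q : {poly K}) (rho : T -> T).
Local Notation X := (mX K).
Local Notation Y := (mY K).

(** For the weights (k, 1) both terms of x + s y^k have weight k, so the shear respects the
    grading. *)
Lemma phi_shear k s p :
  phi k 1 (tri (shear s k) p) = map_poly (tri (shear s k)) (phi k 1 p).
Proof.
rewrite -[LHS]/((phi k 1 \o tri (shear s k)) p) -[RHS]/((map_poly (tri (shear s k)) \o phi k 1) p).
move: p; apply: rmorph2_ext => [c||] /=.
- by rewrite lrmorphC !phiC map_polyC /= lrmorphC.
- rewrite phiX rmorphM /= map_polyC map_polyXn /= triXE /triX /= scale1r evZ evXn.
  rewrite rmorphD /= phiX -mul_mpolyC rmorphM rmorphXn /= phiC phiY exprMn -exprM mul1n.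
  by rewrite -polyC_exp mulrA -polyCM -mulrDl -polyCD.
- rewrite phiY rmorphM /= map_polyC map_polyXn /= triYE /triY /= scale1r mpolyC0 addr0.
  by rewrite phiY.
Qed.

Lemma phi_swp p : phi 1 1 (swp p) = map_poly (@swp K) (phi 1 1 p).
Proof.
rewrite -[LHS]/((phi 1 1 \o @swp K) p) -[RHS]/((map_poly (@swp K) \o phi 1 1) p).
move: p; apply: rmorph2_ext => [c||] /=.
- by rewrite lrmorphC !phiC map_polyC /= lrmorphC.
- by rewrite phiX rmorphM /= map_polyC map_polyXn /= swpX phiY.
- by rewrite phiY rmorphM /= map_polyC map_polyXn /= swpY phiX.
Qed.

(** On the curve x = s y^k the form equals q(s) y^N, where q is its dehomogenization at y = 1. As
    [F] involves x, q is not constant and has a root. *)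
Lemma weighted_root k N (F : T) :
  (forall m, m \in msupp F -> wt k 1 m = N) -> dx F != 0 ->
  exists s, sub (s *: Y ^+ k) Y F = 0.
Proof.
move=> wF /msupp_dx [m0 m0F m00].
pose q := \sum_(m <- msupp F) F@_m *: 'X^(m ord0) : {poly K}.
have qm0 : q`_(m0 ord0) = F@_m0.
  rewrite /q coef_sum (bigD1_seq m0) ?msupp_uniq //= coefZ coefXn eqxx mulr1.
  rewrite big_seq_cond big1 ?addr0 // => m /andP[mF ne].
  rewrite coefZ coefXn; case: eqP => [e|_]; last by rewrite mulr0.
  case/eqP: ne; apply: mnm2P => //.
  by move: (wF m mF) (wF m0 m0F); rewrite /wt e => <-; clear; lia.
have sz : size q != 1%N.
  apply: contraL m0F => /eqP sq; rewrite mcoeff_msupp -qm0 negbK.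
  by rewrite nth_default ?sq.
have [s /rootP qs] := closed_rootP q sz; exists s.
transitivity (q.[s] *: Y ^+ N); last by rewrite qs scale0r.
rewrite {1}[F]mpolyE rmorph_sum /= /q horner_sum scaler_suml.
rewrite big_seq [RHS]big_seq; apply: eq_bigr => m mF.
rewrite linearZ /= mpolyX2 rmorphM !rmorphXn /= subX subY exprZn -exprM.
rewrite -scalerAl -exprD scalerA hornerZ hornerXn; congr (_ *: Y ^+ _).
by rewrite -(wF m mF) /wt mul1n.
Qed.

Definition coordinate f := exists2 rho, is_Kalg_automorphism rho & f = rho Y.

Lemma coordinate_LN f : coordinate f -> locally_nilpotent (jac^~ f).
Proof. by case=> rho arho ->; exact: jac_aut_LN. Qed.

(** The shear moves a root curve of the top form to x = 0, so x divides the new form. That form is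
    in the kernel of its own Jacobian derivation; additivity of the degree puts the factor x there
    too, hence the form has no y. *)
Lemma straighten f k N : (0 < k)%N -> coordinate f ->
  (size (phi k 1 f) <= N.+1)%N -> dx ((phi k 1 f)`_N) != 0 ->
  exists s, let f' := tri (shear s k) f in
    (size (phi k 1 f') <= N.+1)%N /\
    exists m c, [/\ c != 0, (k * m)%N = N & (phi k 1 f')`_N = c *: X ^+ m].
Proof.
move=> k0 [rho arho ef] sz dF; set F := (phi k 1 f)`_N in dF.
have wF m : m \in msupp F -> wt k 1 m = N.
  by rewrite mcoeff_msupp phi_coef; case: ifP => [/eqP //|_]; rewrite eqxx.
have [s Fs] := weighted_root wF dF; exists s => f'.
set tau := tri (shear s k) in f' *.
have atau : is_Kalg_automorphism tau by apply: aut_tri; exact: valid_shear.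
have sz' : (size (phi k 1 f') <= N.+1)%N.
  by rewrite phi_shear; apply: leq_trans (size_poly _ _) sz.
split=> //; set F' := (phi k 1 f')`_N.
have F'E : F' = tau F by rewrite /F' phi_shear coef_map.
have F0 : F != 0 by apply: contraNneq dF => ->; rewrite raddf0.
have F'0 : F' != 0.
  by rewrite F'E; apply: contraNneq F0 => e; rewrite -[F](triK (valid_shear s k)) -/tau e raddf0.
have LNf' : locally_nilpotent (jac^~ f').
  by apply: coordinate_LN; exists (tau \o rho); [exact: aut_comp | rewrite /f' ef].
have LNF' : locally_nilpotent (jac^~ F') by apply: top_LN.
have [r [u]] := sub_diff 0 Y F'.
have -> : sub 0 Y F' = 0.
  by rewrite F'E /tau tri_shear sub_sub rmorphD /= linearZ /= rmorphXn /= subX subY add0r.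
rewrite !subr0 subrr mulr0 addr0 => eF'.
have r0 : r != 0 by apply: contraNneq F'0 => r0; rewrite eF' r0 mul0r.
have X0 : X != 0 by apply: deg_gt0_neq0; rewrite degX.
have dyF' : dy F' = 0.
  have dd := is_der_jac F'.
  have := nuM dd char0 LNF' r0 X0; rewrite -eF'.
  have : (nu LNF' F' <= 1)%N by rewrite (nuP dd) /= jac_self.
  have r1 : (0 < nu LNF' r)%N by rewrite (nu_gt0 dd).
  move=> h1 h2; have : (nu LNF' X <= 1)%N by move: h1 h2 r1; clear; lia.
  by rewrite (nuP dd) /= jacXl => /eqP.
have wF' m : m \in msupp F' -> (k * m ord0 = N)%N /\ m ord_max = 0%N.
  move=> mF'; have m1 := deriv_eq0 char0 dyF' mF'; split=> //.
  move: mF'; rewrite mcoeff_msupp phi_coef; case: ifP => [/eqP + _|_]; last by rewrite eqxx.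
  by rewrite /wt m1 muln0 addn0.
case e : (msupp F') => [|m0 ms].
  by move/eqP: e; rewrite msupp_eq0 (negPf F'0).
have m0F' : m0 \in msupp F' by rewrite e mem_head.
have [w0 w1] := wF' m0 m0F'.
exists (m0 ord0), F'@_m0; split=> //; first by rewrite -mcoeff_msupp.
rewrite {1}(@mpoly1_msupp _ F' m0) => [|m /wF' [w w']].
  by rewrite mpolyX2 w1 expr0 mulr1.
apply: mnm2P; last by rewrite w' w1.
by apply/eqP; rewrite -(eqn_pmul2l k0) w w0.
Qed.
End Straighten.

(** * The Jung-van der Kulk theorem *)

Section Jung.
Variable K : closedFieldType.
Hypothesis char0 : [pchar K] =i pred0.
Local Notation T := {mpoly K[2]}.
Implicit Types (p q f g h : T) (P Q : {poly K}) (rho : T -> T) (l : letter K).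
Local Notation X := (mX K).
Local Notation Y := (mY K).

(** The constant Jacobian determines [dx (rho X)], which leaves only a polynomial in y undetermined
    in [rho X]. *)
Lemma aut_tri_form rho mu nu : is_Kalg_automorphism rho ->
  rho Y = mu *: Y + nu%:MP -> exists2 l, valid l & rho =1 tri l.
Proof.
move=> arho eY; have [c c0] := jac_aut arho.
have dyE : dy (rho Y) = mu%:MP.
  by rewrite eY raddfD /= linearZ /= dyY dyC addr0 -mul_mpolyC mulr1.
have dxE : dx (rho Y) = 0.
  by rewrite eY raddfD /= linearZ /= dxY dxC addr0 scaler0.
rewrite /jac dyE dxE mulr0 subr0 => ej.
have mu0 : mu != 0.
  by apply: contraNneq c0 => e; rewrite e mpolyC0 mulr0 in ej; rewrite -(mpolyC_eq0 2) -ej.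
have ex : dx (rho X) = (c / mu)%:MP.
  by rewrite mpolyCM -ej -mulrA -mpolyCM mulfV // mpolyC1 mulr1.
have [|P eP] := @dx_eq0_ev _ char0 (rho X - (c / mu) *: X).
  by rewrite raddfB /= linearZ /= dxX ex -mul_mpolyC mulr1 subrr.
exists (Letter (c / mu) mu nu P).
  by rewrite /valid /= mu0 mulf_neq0 ?invr_eq0.
move=> p; rewrite (autE arho) /tri /triX /triY /= -eP eY.
by rewrite [_ *: X + _]addrC subrK.
Qed.

Section Induction.
Variable W : (T -> T) -> Prop.
Hypothesis W_ext : forall rho rho', rho =1 rho' -> W rho -> W rho'.
Hypothesis W_tri : forall l, valid l -> W (tri l).
Hypothesis W_tri_comp : forall l rho, valid l -> W rho -> W (tri l \o rho).
Hypothesis W_swp_comp : forall rho, W rho -> W (@swp K \o rho).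

Lemma W_tri_inv l rho : valid l -> W (tri l \o rho) -> W rho.
Proof.
move=> vl /(W_tri_comp (valid_linv vl)); apply: W_ext => p /=.
by rewrite triK.
Qed.

Lemma W_swp_inv rho : W (@swp K \o rho) -> W rho.
Proof. by move=> /W_swp_comp; apply: W_ext => p /=; rewrite swpK. Qed.

Lemma W_linear rho : is_Kalg_automorphism rho -> (deg (rho Y) <= 1)%N -> W rho.
Proof.
move=> arho /mpoly_deg1; set la := _@_U_(ord0); set mu := _@_U_(ord_max).
set nu := _@_0 => eY; have [la0|la0] := eqVneq la 0.
  rewrite la0 scale0r add0r in eY.
  have [l vl e] := aut_tri_form arho eY.
  by apply: W_ext (W_tri vl) => p; rewrite e.
(* This letter turns [rho Y] into x + nu, and the swap turns that into y + nu. *)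
pose l := Letter la^-1 1 0 (- (la^-1 * mu) *: 'X).
have vl : valid l by rewrite /valid /= invr_eq0 la0 oner_eq0.
apply: (W_tri_inv vl); apply: W_swp_inv.
have a' : is_Kalg_automorphism (@swp K \o (tri l \o rho)).
  by apply: aut_comp; [exact: aut_swp|apply: aut_comp => //; exact: aut_tri].
have [|l' vl' e] := @aut_tri_form _ 1 nu a'.
  rewrite /= eY !linearD !linearZ /= triXE triYE /triX /triY !lrmorphC /= evZ evX.
  rewrite !linearD !linearZ /= swpX swpY !lrmorphC !scale1r mpolyC0.
  rewrite scaler0 addr0 !scalerA mulNr [la^-1 * mu * la]mulrAC mulVf // mul1r.
  by rewrite scale1r scaleNr subrK.
by apply: W_ext (W_tri vl') => p; rewrite e.
Qed.

Section Step.
Variable n : nat.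
Hypothesis n2 : (2 <= n)%N.
Hypothesis IH : forall rho, is_Kalg_automorphism rho -> (deg (rho Y) < n)%N -> W rho.

(** Straightening along the edge at y^n makes the (k, 1)-top form a multiple of x^m with k m = n and
    k >= 2, so the degree of [rho Y] drops. *)
Lemma W_vertical rho : is_Kalg_automorphism rho ->
  (U_(ord_max) *+ n)%MM \in msupp (rho Y) ->
  (forall m, m \in msupp (rho Y) -> m <> (U_(ord_max) *+ n)%MM -> (mdeg m < n)%N) ->
  W rho.
Proof.
move=> arho Un small.
have cf : coordinate (rho Y) by exists rho.
(* If [rho Y] were free of x, the Jacobian would make [dy (rho Y)] a unit, but y^n with n >= 2
   contributes a nonconstant term to it. *)
have dxf : dx (rho Y) != 0.
  apply/eqP => dx0; have [c c0] := jac_aut arho.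
  rewrite /jac dx0 mulr0 subr0 => ej.
  have : dy (rho Y) * ((c^-1)%:MP * dx (rho X)) = 1.
    by rewrite mulrCA [dy _ * _]mulrC ej -mpolyCM mulVf // mpolyC1.
  rewrite mulrC => /mpoly_intro_unit /andP[/eqP e _].
  have := @deriv_msupp _ char0 ord_max _ _ Un; rewrite mnmX_comp eqxx => /(_ (ltnW n2)).
  rewrite -/(dy (rho Y)) e mcoeffC.
  have [/mnmP /(_ ord_max)|_] := eqVneq (U_(ord_max) *+ n - U_(ord_max))%MM 0%MM; last first.
    by rewrite mulr0 eqxx.
  by rewrite mnmBE mnmX_comp mnm1E mnm0E eqxx /= => /eqP; rewrite subn_eq0 leqNgt n2.
have [k [k2 wle [m1 m1f [m10 em1]]]] := edge_slope char0 (coordinate_LN cf) Un small dxf.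
have k0 := ltnW k2.
have sz : (size (phi k 1 (rho Y)) <= n.+1)%N.
  by apply: size_phi_le => m mf; rewrite /wt mul1n; exact: wle.
have dF : dx ((phi k 1 (rho Y))`_n) != 0.
  have m1F : m1 \in msupp (phi k 1 (rho Y))`_n.
    by rewrite mcoeff_msupp phi_coef /wt m10 muln1 mul1n em1 eqxx -mcoeff_msupp.
  by apply/eqP => /(deriv_eq0 char0) /(_ _ m1F); rewrite m10.
have [s [sz' [m [c [c0 km eF]]]]] := straighten char0 k0 cf sz dF.
apply: (W_tri_inv (valid_shear s k)); apply: IH.
  by apply: aut_comp => //; apply: aut_tri; exact: valid_shear.
rewrite /deg /=; suff : (msize (tri (shear s k) (rho Y)) <= n)%N.
  by move: n2; clear; lia.
apply: msize_le => m' m'f; rewrite mdeg2.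
(* Weight below n already bounds the total degree below n; at weight exactly n the only monomial is
   x^m, of degree m < n. *)
have := size_phi_leP sz' m'f; rewrite leq_eqVlt => /orP[/eqP e|]; last first.
  by move: k0; rewrite /wt; clear; nia.
have := phi_coef k 1 (tri (shear s k) (rho Y)) n m'; rewrite e eqxx eF.
move: m'f; rewrite mcoeff_msupp => h1 h2; rewrite -h2 in h1.
have Xm : X ^+ m = 'X_[U_(ord0) *+ m].
  by rewrite mpolyX2 !mnmX_comp /= expr0 mulr1.
rewrite mcoeffZ Xm mcoeffX in h1.
have em' : m' = (U_(ord0) *+ m)%MM.
  by apply/esym/eqP; apply: contraNT h1 => /negPf ->; rewrite mulr0.
rewrite em' !mnmX_comp /= addn0 -km; move: n2 k2; rewrite -km; clear; nia.
Qed.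

(** If the top form involves x, a shear x + s y and the swap make it a multiple of y^n; if not, it
    already is one. *)
Lemma W_degree rho : is_Kalg_automorphism rho -> deg (rho Y) = n -> W rho.
Proof.
move=> arho dn; set f := rho Y in dn.
have cf : coordinate f by exists rho.
have sz : (size (phi 1 1 f) <= n.+1)%N.
  apply: size_phi_le => m mf; rewrite /wt !mul1n -mdeg2.
  by have := msize_mdeg_lt mf; rewrite -dn /deg; case: (msize f).
have f0 : f != 0 by apply: deg_gt0_neq0; rewrite dn (ltnW n2).
have [dF|dF] := eqVneq (dx (phi 1 1 f)`_n) 0.
  have top m : m \in msupp f -> mdeg m = n -> m = (U_(ord_max) *+ n)%MM.
    move=> mf em; have mF : m \in msupp (phi 1 1 f)`_n.
      by rewrite mcoeff_msupp phi_coef /wt !mul1n -mdeg2 em eqxx -mcoeff_msupp.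
    have m0 := deriv_eq0 char0 dF mF.
    by apply: mnm2P; rewrite mnmX_comp //= -em mdeg2 m0.
  apply: W_vertical => //.
    have lm := mlead_supp f0; rewrite -(top _ lm) //.
    by have := mlead_deg f0; rewrite -dn /deg => <-.
  move=> m mf ne; have := size_phi_leP sz mf.
  rewrite /wt !mul1n -mdeg2 leq_eqVlt => /orP[/eqP e|//].
  by case: ne; apply: top.
have [s [sz' [m [c [c0 km eF]]]]] := straighten char0 (ltn0Sn 0) cf sz dF.
rewrite mul1n in km; rewrite km in eF.
apply: (W_tri_inv (valid_shear s 1)); apply: W_swp_inv.
have a' : is_Kalg_automorphism (@swp K \o (tri (shear s 1) \o rho)).
  apply: aut_comp; first exact: aut_swp.
  by apply: aut_comp => //; apply: aut_tri; exact: valid_shear.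
have sz2 : (size (phi 1 1 ((@swp K \o (tri (shear s 1) \o rho)) Y)) <= n.+1)%N.
  by rewrite /= phi_swp; apply: leq_trans (size_poly _ _) sz'.
have eF2 : (phi 1 1 ((@swp K \o (tri (shear s 1) \o rho)) Y))`_n = c *: 'X_[U_(ord_max) *+ n].
  rewrite /= phi_swp coef_map eF /= linearZ rmorphXn /= swpX.
  by rewrite mpolyX2 !mnmX_comp /= expr0 mul1r.
set g := (_ \o _) Y in sz2 eF2.
have gE m' : mdeg m' = n -> g@_m' = c * (U_(ord_max) *+ n == m')%MM%:R.
  move=> em; have := phi_coef 1 1 g n m'.
  by rewrite /wt !mul1n -mdeg2 em eqxx eF2 mcoeffZ mcoeffX => <-.
apply: W_vertical => //; rewrite -/g.
  rewrite mcoeff_msupp gE ?eqxx ?mulr1 //.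
  by rewrite mdegMn mdeg1 mul1n.
move=> m' mg ne; have := size_phi_leP sz2 mg.
rewrite /wt !mul1n -mdeg2 leq_eqVlt => /orP[/eqP e|//].
move: mg; rewrite mcoeff_msupp gE //.
by have [e'|_] := eqVneq (U_(ord_max) *+ n)%MM m'; [case: ne | rewrite mulr0 eqxx].
Qed.
End Step.

(** Only the degree of the image of y is measured; at degree one the Jacobian recovers the image of
    x. As generators are invertible, [W] can be pulled back from the simplified automorphism to the
    original one. *)
Theorem jung_ind rho : is_Kalg_automorphism rho -> W rho.
Proof.
have [n] := ubnP (deg (rho Y)); elim: n rho => // n IHn rho ltn arho.
case: (leqP (deg (rho Y)) 1) => [le1|gt1]; first exact: W_linear.
apply: (W_degree gt1) => // rho' arho' lt'; apply: IHn => //.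
exact: leq_trans lt' _.
Qed.
End Induction.
End Jung.

(** * Univariate polynomials under a shift *)

Section UnivariateShift.
Variable R : idomainType.
Hypothesis char0 : [pchar R] =i pred0.

(** A periodic polynomial takes its value at 0 at every multiple of [c], and in characteristic zero
    these multiples are distinct. [R] is a domain because it will be K[x, y]. *)
Lemma shift_invariant_const (q : {poly R}) c :
  c != 0 -> q \Po ('X + c%:P) = q -> (size q <= 1)%N.
Proof.
move=> c0 qc; set p := q - (q.[0])%:P.
have qn n : q.[c *+ n] = q.[0].
  elim: n => [|n IH]; first by rewrite mulr0n.
  by rewrite -IH -{2}qc horner_comp !hornerE mulrSr.
suff p0 : p = 0 by move/subr0_eq: p0 => ->; rewrite size_polyC leq_b1.
apply/eqP; apply: contraT => p0; exfalso.
have := @max_poly_roots _ p [seq c *+ i | i <- iota 0 (size p)] p0.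
rewrite size_map size_iota ltnn => /(_ _ _) H; suff : false by []; apply: H.
  by apply/allP => x /mapP[i _ ->]; rewrite rootE !hornerE qn subrr.
rewrite map_inj_in_uniq ?iota_uniq // => i j _ _ e.
wlog le : i j e / (i <= j)%N.
  by move=> H; case: (leqP i j) => [|/ltnW] h; [|symmetry]; apply: H.
move/eqP: e; rewrite -(subnK le) mulrnDr -subr_eq0 opprD addrCA subrr addr0 oppr_eq0.
rewrite -mulr_natr mulf_eq0 (negPf c0) /=.
move/pcharf0P: char0 => -> /eqP e0; move: le e0; clear; lia.
Qed.
End UnivariateShift.

Section UnivariateEquations.
Variable K : fieldType.
Hypothesis char0 : [pchar K] =i pred0.
Implicit Types (P Q H : {poly K}).

Lemma natf_neq0 n : (n.+1)%:R != 0 :> K.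
Proof. by move/pcharf0P: char0 => ->. Qed.

(** A shift preserves the leading coefficient, so its only eigenvalue is 1. *)
Lemma shift_eigen_eq0 Q c be :
  be != 1 -> Q \Po ('X + c%:P) = be *: Q -> Q = 0.
Proof.
move=> be1 e; apply/eqP; apply: contraT => Q0; exfalso.
have := congr1 lead_coef e; rewrite lead_coef_comp ?size_XaddC // lead_coefXaddC.
rewrite expr1n mulr1 lead_coefZ => /eqP; rewrite -subr_eq0 -{1}[lead_coef Q]mul1r.
by rewrite -mulrBl mulf_eq0 lead_coef_eq0 (negPf Q0) orbF subr_eq0 eq_sym (negPf be1).
Qed.

Lemma exprXaddC_top c n : exists2 r : {poly K}, (size r <= n)%N &
  ('X + c%:P) ^+ n.+1 = 'X^(n.+1) + (n.+1%:R * c) *: 'X^n + r.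
Proof.
elim: n => [|n [r sr e]].
  by exists 0; rewrite ?size_poly0 // !expr1 expr0 addr0 mul1r alg_polyC.
exists (r * 'X + (n.+1%:R * c * c) *: 'X^n + c *: r).
  apply: leq_trans (size_polyD _ _) _; rewrite geq_max; apply/andP; split.
    apply: leq_trans (size_polyD _ _) _; rewrite geq_max; apply/andP; split.
      by apply: leq_trans (size_polyMleq _ _) _; rewrite size_polyX addn2.
    by apply: leq_trans (size_scale_leq _ _) _; rewrite size_polyXn.
  by apply: leq_trans (size_scale_leq _ _) _; apply: leqW.
rewrite exprS e -[n.+2%:R]natr1 -!mul_polyC !polyCM polyCD polyC_natr polyC1 !exprS.
ring.
Qed.

(** The operator scales leading coefficients by 1 - al if al is not 1; otherwise it lowers the
    degree of X^(n+1) to n with the nonzero factor (n+1) c. In both cases the top coefficient of [P]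
    can be removed. *)
Lemma twisted_difference_surj al c P : c != 0 ->
  exists H, H \Po ('X + c%:P) - al *: H = P.
Proof.
move=> c0; have [n] := ubnPleq (size P); elim: n P => [|n IH] P sP.
  exists 0; rewrite comp_poly0 scaler0 subrr.
  by apply/esym/eqP; rewrite -size_poly_leq0.
suff [H0 hH0] : exists H0, (size (P - (H0 \Po ('X + c%:P) - al *: H0))%R <= n)%N.
  have [H eH] := IH _ hH0; exists (H0 + H).
  by rewrite comp_polyD scalerDr opprD addrACA eH addrC subrK.
have sPn : (size (P - P`_n *: 'X^n)%R <= n)%N.
  apply/leq_sizeP => j nj; rewrite coefB coefZ coefXn.
  have [->|ne] := eqVneq j n; first by rewrite mulr1 subrr.
  rewrite mulr0 subr0 nth_default //; apply: leq_trans sP _.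
  by rewrite ltn_neqAle eq_sym ne.
have [e|al1] := eqVneq al 1.
  have [r sr er] := exprXaddC_top c n.
  pose d := P`_n / (n.+1%:R * c); exists (d *: 'X^(n.+1)).
  rewrite comp_polyZ comp_Xn_poly er e scale1r -scalerBr.
  have -> : 'X^(n.+1) + (n.+1%:R * c) *: 'X^n + r - 'X^(n.+1) = (n.+1%:R * c) *: 'X^n + r.
    by rewrite -[_ + _ + r]addrA addrAC subrr add0r.
  rewrite scalerDr scalerA divfK ?mulf_neq0 ?natf_neq0 // opprD addrA.
  apply: leq_trans (size_polyD _ _) _; rewrite size_polyN geq_max sPn.
  exact: leq_trans (size_scale_leq _ _) sr.
have al1' : 1 - al != 0 by rewrite subr_eq0 eq_sym.
have [r sr er] : exists2 r : {poly K}, (size r <= n)%N & ('X + c%:P) ^+ n = 'X^n + r.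
  case: n {IH sP sPn} => [|n]; first by exists 0; rewrite ?size_poly0 // !expr0 addr0.
  have [r sr ->] := exprXaddC_top c n; exists ((n.+1%:R * c) *: 'X^n + r); last by rewrite addrA.
  apply: leq_trans (size_polyD _ _) _; rewrite geq_max (leqW sr) andbT.
  by apply: leq_trans (size_scale_leq _ _) _; rewrite size_polyXn.
exists ((P`_n / (1 - al)) *: 'X^n).
set d := P`_n / (1 - al).
have -> : (d *: 'X^n) \Po ('X + c%:P) - al *: (d *: 'X^n) = P`_n *: 'X^n + d *: r.
  rewrite comp_polyZ comp_Xn_poly er scalerDr scalerA addrAC -scalerBl.
  by congr (_ *: _ + _); rewrite -[X in X - _]mul1r -mulrBl mulrC /d divfK.
rewrite opprD addrA; apply: leq_trans (size_polyD _ _) _; rewrite size_polyN geq_max sPn.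
exact: leq_trans (size_scale_leq _ _) sr.
Qed.

Lemma antiderivative P : exists Q, Q^`() = P.
Proof.
(* The coefficient at i = 0 divides by zero; differentiation discards it. *)
exists (\poly_(i < (size P).+1) (P`_i.-1 / i%:R)); apply/polyP => i.
rewrite coef_deriv coef_poly ltnS; case: ltnP => h.
  by rewrite -[LHS]mulr_natr divfK // natf_neq0.
by rewrite mul0rn nth_default.
Qed.
End UnivariateEquations.

(** * Rigidity: conjugation, invariant curves, fixed points *)

Section Rigid.
Variable K : fieldType.
Local Notation T := {mpoly K[2]}.
Implicit Types (p q f g h : T) (P Q : {poly K}) (rho phi psi D : T -> T).
Local Notation X := (mX K).
Local Notation Y := (mY K).

Definition rigid rho := forall D, is_derivation D -> simple_derivation D ->
  (forall f, rho (D f) = D (rho f)) -> rho =1 id.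

Lemma rigid_ext rho rho' : rho =1 rho' -> rigid rho -> rigid rho'.
Proof.
by move=> e r D dD sD c p; rewrite -e; apply: (r D) => // f; rewrite !e.
Qed.

(** A derivation commuting with psi o phi is transported by [phi] to one commuting with phi o psi;
    stable ideals of the latter pull back along [phi]. *)
Lemma rigid_conj phi psi : is_Kalg_automorphism phi ->
  rigid (phi \o psi) -> rigid (psi \o phi).
Proof.
move=> aphi r D dD sD comm.
have [phi' [aphi' c1 c2]] := aut_inv aphi.
have [L M _ _] := aphi; have [L' M' _ _] := aphi'.
pose D' := phi \o D \o phi'.
have dD' : is_derivation D'.
  split=> [c p q|p q]; rewrite /D' /=.
    by rewrite L' derB_lin // L.
  rewrite M' derM //; have -> u v : phi (u + v) = phi u + phi v.
    by have := L 1 u v; rewrite !scale1r.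
  by rewrite !M !c2.
have sD' : simple_derivation D'.
  move=> I [I0 ID IM] [f [If f0]] [g Ig] st.
  apply: (sD (fun h => I (phi h))).
  - have phi0 : phi 0 = 0 by rewrite (autE aphi 0) rmorph0.
    split=> [|a b|a b]; first by rewrite phi0.
      by rewrite (autE aphi (a + b)) rmorphD /= -!(autE aphi); exact: ID.
    by rewrite M; exact: IM.
  - exists (phi' f); rewrite c2; split=> // e; apply: f0.
    by rewrite -(c2 f) e (autE aphi 0) rmorph0.
  - by exists (phi' g); rewrite c2.
  - by move=> h /st; rewrite /D' /= c1.
have id' := r D' dD' sD'; move=> p /=.
have {}id' : (phi \o psi) =1 id.
  by apply: id' => h; have := comm (phi' h); rewrite /D' /= c2 c1 => ->.
by rewrite -[psi _]c1 -[phi (psi _)]/((phi \o psi) (phi p)) id' c1.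
Qed.

Section Simple.
Variable D : T -> T.
Hypothesis dD : is_derivation D.
Hypothesis sD : simple_derivation D.

(** The principal ideal of [h] is stable and nonzero, and it is proper for reasons of degree. *)
Lemma simple_no_darboux h r : D h = r * h -> (0 < deg h)%N -> False.
Proof.
move=> Dh dh; have h0 := deg_gt0_neq0 dh.
apply: (sD (I := fun p => exists s, p = s * h)).
- split=> [|a b [s ->] [t ->]|t a [s ->]]; first by exists 0; rewrite mul0r.
    by exists (s + t); rewrite mulrDl.
  by exists (t * s); rewrite mulrA.
- by exists h; split; [exists 1; rewrite mul1r | apply/eqP].
- exists 1 => -[s e]; have s0 : s != 0.
    by apply/eqP => s0; move/eqP: e; rewrite s0 mul0r oner_eq0.
  have := congr1 (@deg K) e; rewrite degM // -mpolyC1 degC; move: dh; clear; lia.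
- by move=> f [s ->]; exists (D s + s * r); rewrite derM // Dh mulrDl [h * _]mulrC mulrA.
Qed.

Lemma simple_fixed_point f g x0 y0 :
  (forall p, sub f g (D p) = D (sub f g p)) ->
  sub x0%:MP y0%:MP f = x0%:MP -> sub x0%:MP y0%:MP g = y0%:MP ->
  sub f g =1 id.
Proof.
move=> comm fx fy.
pose I p := exists r s, p = r * (X - f) + s * (Y - g).
have [/andP[/eqP ef /eqP eg]|ne] := boolP ((f == X) && (g == Y)).
  by move=> p; rewrite ef eg sub_id.
exfalso; apply: (sD (I := I)).
- split=> [|a b [r [s ->]] [r' [s' ->]]|t a [r [s ->]]].
  + by exists 0, 0; rewrite !mul0r addr0.
  + by exists (r + r'), (s + s'); ring.
  + by exists (t * r), (t * s); ring.
- move: ne; rewrite negb_and => /orP[] ne.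
    exists (X - f); split; first by exists 1, 0; rewrite mul1r mul0r addr0.
    by apply/eqP; rewrite subr_eq0 eq_sym.
  exists (Y - g); split; first by exists 0, 1; rewrite mul1r mul0r add0r.
  by apply/eqP; rewrite subr_eq0 eq_sym.
- exists 1 => -[r [s e]]; have := congr1 (sub x0%:MP y0%:MP) e.
  rewrite rmorph1 rmorphD !rmorphM /= !rmorphB /= subX subY fx fy !subrr !mulr0 addr0.
  by move/eqP; rewrite oner_eq0.
- move=> p [r [s ->]].
  (* Commutation gives D (x - f) = D x - rho (D x), which [sub_diff] places in the ideal. *)
  have DX : I (D (X - f)).
    by have := sub_diff f g (D X); rewrite comm subX -derB.
  have DY : I (D (Y - g)).
    by have := sub_diff f g (D Y); rewrite comm subY -derB.
  case: DX => r1 [s1 e1]; case: DY => r2 [s2 e2].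
  exists (D r + r * r1 + s * r2), (D s + r * s1 + s * s2).
  rewrite (der_add dD) !(derM dD) e1 e2; clear.
  by move: (X - f) (Y - g) (D r) (D s) => u v dr ds; ring.
Qed.
End Simple.

Lemma ev_inj q : (0 < deg q)%N -> injective (fun P => ev P q).
Proof.
move=> dq P Q /= e; apply/eqP; rewrite -subr_eq0; apply: contraT => n0.
by have [+ _] := deg_ev dq n0; rewrite evB e subrr eqxx.
Qed.

Lemma ev_const P c : ev P c%:MP = (P.[c])%:MP.
Proof.
elim/poly_ind: P => [|P d IH]; first by rewrite ev0 horner0 mpolyC0.
by rewrite !(evD, evM, evC, evX) IH hornerMXaddC mpolyCD mpolyCM.
Qed.
End Rigid.

(** * Rigidity of triangular automorphisms *)

Section RigidTriangular.
Variable K : closedFieldType.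
Hypothesis char0 : [pchar K] =i pred0.
Local Notation T := {mpoly K[2]}.
Implicit Types (p q f g h : T) (P Q : {poly K}) (rho D : T -> T) (l : letter K).
Local Notation X := (mX K).
Local Notation Y := (mY K).

Lemma pchar_mpoly : [pchar T] =i pred0.
Proof.
apply/pcharf0P => n; rewrite -mpolyC_nat mpolyC_eq0.
by move/pcharf0P: char0 => ->.
Qed.

(** The polynomial viewed in y over K[x], with K[x] kept inside K[x, y] so that univariate results
    over a domain apply. *)
Definition unY (p : T) : {poly T} :=
  mmap (polyC \o @mpolyC 2 K) (fun i => if i == ord0 then X%:P else 'X) p.
HB.instance Definition _ := GRing.RMorphism.copy unY
  (mmap (polyC \o @mpolyC 2 K) (fun i => if i == ord0 then X%:P else 'X)).

Lemma unYC c : unY c%:MP = c%:MP%:P.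
Proof. by rewrite /unY mmapC. Qed.
Lemma unYX : unY X = X%:P.
Proof. by rewrite /unY mmapX mmap1U. Qed.
Lemma unYY : unY Y = 'X.
Proof. by rewrite /unY mmapX mmap1U. Qed.

Lemma horner_unY p q : (unY p).[q] = sub X q p.
Proof.
move: p; apply: mpoly2_ind => [c|||p r ep er|p r ep er].
- by rewrite unYC hornerC subC.
- by rewrite unYX hornerC subX.
- by rewrite unYY hornerX subY.
- by rewrite (rmorphD unY) hornerD [RHS]rmorphD; congr (_ + _).
- by rewrite (rmorphM unY) hornerM [RHS]rmorphM; congr (_ * _).
Qed.

Lemma unY_shift c p : unY (sub X (Y + c%:MP) p) = unY p \Po ('X + c%:MP%:P).
Proof.
rewrite -[LHS]/((unY \o sub X (Y + c%:MP)) p).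
rewrite -[RHS]/((comp_poly ('X + c%:MP%:P) \o unY) p).
move: p; apply: rmorph2_ext => [d||] /=.
- by rewrite subC unYC comp_polyC.
- by rewrite subX unYX comp_polyC.
- by rewrite subY (rmorphD unY) /= unYY unYC comp_polyX.
Qed.

Lemma shiftY_invariant c p : c != 0 -> sub X (Y + c%:MP) p = p ->
  exists P, p = ev P X.
Proof.
move=> c0 e; apply: dy_eq0_ev => //.
have sz : (size (unY p) <= 1)%N.
  apply: (shift_invariant_const pchar_mpoly (c := c%:MP)); first by rewrite mpolyC_eq0.
  by rewrite -unY_shift e.
have ep : p = sub X 0 p.
  rewrite -horner_unY -{1}[p]sub_id -horner_unY.
  by rewrite (size1_polyC sz) !hornerC.
by rewrite ep dy_sub dyX raddf0 !mulr0 addr0.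
Qed.

(** Periodicity in y gives D x = A(x) and D y = B(x). A root of A gives an invariant vertical line;
    if A is a nonzero constant a, then D kills y - C(x) with C' = B / a. *)
Lemma rigid_translation c : c != 0 -> rigid (tri (Letter 1 1 c (0 : {poly K}))).
Proof.
move=> c0 D dD sD comm; exfalso.
have rhoE p : tri (Letter 1 1 c 0) p = sub X (Y + c%:MP) p.
  by rewrite /tri /triX /triY /= ev0 addr0 !scale1r.
have [|A eA] := @shiftY_invariant c (D X) c0; first by rewrite -rhoE comm rhoE subX.
have [|B eB] := @shiftY_invariant c (D Y) c0.
  by rewrite -rhoE comm rhoE subY (der_add dD) (derC dD) addr0.
have [sA|sA] := eqVneq (size A) 1%N; last first.
  have [x /factor_theorem [A' eA']] := closed_rootP A sA.
  apply: (@simple_no_darboux K D dD sD (X - x%:MP) (ev A' X)).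
    by rewrite (derB dD) (derC dD) subr0 eA eA' evM evB evX evC.
  by rewrite addrC degDr ?degX // degN degC.
have [a a0 ea] : exists2 a, a != 0 & A = a%:P.
  by move/eqP/size_poly1P: sA => [a a0 ->]; exists a.
have [C eC] := antiderivative char0 (a^-1 *: B).
have dh : (0 < deg (Y - ev C X))%N.
  rewrite lt0n; apply/eqP => /deg0_const e; have := congr1 (@dy K) e.
  rewrite raddfB /= dyY dy_ev dyX mulr0 subr0 dyC => /eqP.
  by rewrite oner_eq0.
apply: (@simple_no_darboux K D dD sD (Y - ev C X) 0) => //.
rewrite (derB dD) (der_ev _ _ dD) eA eB eC ea evC evZ mul0r.
by rewrite mulrC mul_mpolyC scalerA mulfV // scale1r subrr.
Qed.

(** The line x = 0 is preserved by [rho], which translates it. On it D x is an eigenvector of a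
    shift with eigenvalue al, hence zero, so x divides D x. *)
Lemma rigid_scaled_translation al c : al != 0 -> al != 1 -> c != 0 ->
  rigid (tri (Letter al 1 c (0 : {poly K}))).
Proof.
move=> al0 al1 c0 D dD sD comm; exfalso.
have rhoE p : tri (Letter al 1 c 0) p = sub (al *: X) (Y + c%:MP) p.
  by rewrite /tri /triX /triY /= ev0 addr0 !scale1r.
have ea : sub (al *: X) (Y + c%:MP) (D X) = al *: D X.
  by rewrite -rhoE comm rhoE subX (derZ dD).
have [|Q eQ] := @dx_eq0_ev _ char0 (sub 0 Y (D X)).
  by rewrite dx_sub raddf0 dxY !mulr0 addr0.
have Q0 : Q = 0.
  apply: (shift_eigen_eq0 al1 (c := c)); apply: (@ev_inj K Y); first by rewrite degY.
  rewrite /= ev_comp evZ evD evX evC -eQ.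
  have := congr1 (sub 0 Y) ea.
  rewrite sub_sub linearZ linearD /= linearZ /= subX subY subC scaler0 => <-.
  by have := congr1 (sub 0 (Y + c%:MP)) eQ; rewrite sub_ev sub_sub rmorph0 subY => ->.
rewrite Q0 ev0 in eQ.
have [r [s]] := sub_diff 0 Y (D X); rewrite eQ !subr0 subrr mulr0 addr0 => e.
by apply: (@simple_no_darboux K D dD sD X r) => //; rewrite degX.
Qed.

(** The constant term makes the line y = y0 invariant, and [rho] translates it by P(y0). As an
    eigenvector of this shift with eigenvalue be, D y vanishes there. *)
Lemma rigid_sheared_scaling be y0 P : be != 1 -> P.[y0] != 0 ->
  rigid (tri (Letter 1 be ((1 - be) * y0) P)).
Proof.
move=> be1 Py D dD sD comm; exfalso.
have rhoE p : tri (Letter 1 be ((1 - be) * y0) P) p =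
    sub (X + ev P Y) (be *: Y + ((1 - be) * y0)%:MP) p.
  by rewrite /tri /triX /triY /= !scale1r.
have eb : sub (X + ev P Y) (be *: Y + ((1 - be) * y0)%:MP) (D Y) = be *: D Y.
  by rewrite -rhoE comm rhoE subY (der_add dD) (derC dD) addr0 (derZ dD).
have [|Q eQ] := @dy_eq0_ev _ char0 (sub X y0%:MP (D Y)).
  by rewrite dy_sub dyX dyC !mulr0 addr0.
have Q0 : Q = 0.
  apply: (shift_eigen_eq0 be1 (c := P.[y0])); apply: (@ev_inj K X); first by rewrite degX.
  rewrite /= ev_comp evZ evD evX evC -eQ.
  have := congr1 (sub X y0%:MP) eb.
  rewrite sub_sub linearZ !linearD /= linearZ /= subX subY subC sub_ev subY ev_const => <-.
  have -> : be *: y0%:MP + ((1 - be) * y0)%:MP = y0%:MP :> T.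
    by rewrite -mul_mpolyC -mpolyCM -mpolyCD; congr (_%:MP); ring.
  have := congr1 (sub (X + (P.[y0])%:MP) Y) eQ.
  by rewrite sub_ev sub_sub subX subC => ->.
rewrite Q0 ev0 in eQ.
have [r [s]] := sub_diff X y0%:MP (D Y); rewrite eQ subr0 subrr mulr0 add0r => e.
apply: (@simple_no_darboux K D dD sD (Y - y0%:MP) s).
  by rewrite (derB dD) (derC dD) subr0.
by rewrite addrC degDr ?degY // degN degC.
Qed.

Lemma rigid_tri_fixed_point l x0 y0 :
  l_al l * x0 + (l_P l).[y0] = x0 -> l_be l * y0 + l_ga l = y0 -> rigid (tri l).
Proof.
move=> ex ey D dD sD comm.
apply: (simple_fixed_point dD sD (x0 := x0) (y0 := y0) comm).
  rewrite /triX rmorphD /= linearZ /= subX sub_ev subY ev_const -mul_mpolyC -mpolyCM.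
  by rewrite -mpolyCD ex.
by rewrite /triY rmorphD /= linearZ /= subY subC -mul_mpolyC -mpolyCM -mpolyCD ey.
Qed.

Lemma rigid_tri l : valid l -> rigid (tri l).
Proof.
case: l => al be ga P /andP[/= al0 be0].
have solve (u v : K) : u != 1 -> u * (v / (1 - u)) + v = v / (1 - u).
  by move=> u1; field; rewrite subr_eq0 eq_sym.
have [be1|be1] := eqVneq be 1; last first.
  pose y0 := ga / (1 - be); have ey : be * y0 + ga = y0 by apply: solve.
  have [al1|al1] := eqVneq al 1; last first.
    by apply: (@rigid_tri_fixed_point _ (P.[y0] / (1 - al)) y0) => //=; apply: solve.
  have [Py|Py] := eqVneq P.[y0] 0.
    by apply: (@rigid_tri_fixed_point _ 0 y0) => //=; rewrite Py mulr0 addr0.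
  have -> : ga = (1 - be) * y0 by rewrite mulrC divfK // subr_eq0 eq_sym.
  by rewrite al1; apply: rigid_sheared_scaling.
rewrite be1; have [ga0|ga0] := eqVneq ga 0.
  have [al1|al1] := eqVneq al 1; last first.
    apply: (@rigid_tri_fixed_point _ (P.[0] / (1 - al)) 0) => /=; first exact: solve.
    by rewrite ga0 mulr0 addr0.
  have [/eqP sP|sP] := eqVneq (size P) 1%N; last first.
    have [y /rootP Py] := closed_rootP P sP.
    apply: (@rigid_tri_fixed_point _ 0 y) => /=; first by rewrite Py mulr0 addr0.
    by rewrite ga0 mul1r addr0.
  (* With P a nonzero constant the map translates x; conjugation by the swap makes it translate
     y. *)
  have [c c0 ->] := size_poly1P _ sP.
  rewrite al1 ga0; set l := Letter _ _ _ _.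
  apply: (@rigid_ext _ ((tri l \o @swp K) \o @swp K)); first by move=> p /=; rewrite swpK.
  apply: rigid_conj; first exact: aut_swp.
  apply: rigid_ext (rigid_translation c0) => p.
  apply: (@sub_ext _ (tri _) (@swp K \o (tri l \o @swp K))) => /=.
    rewrite swpX triXE triYE /triX /triY /= !scale1r ev0 mpolyC0 !addr0.
    by rewrite swpY.
  rewrite swpY triXE triYE /triX /triY /= !scale1r evC rmorphD /= lrmorphC.
  by rewrite swpX.
(* Conjugation by x -> x + H(y) removes P exactly when H(y + ga) - al H(y) = - P(y). *)
have [H eH] := twisted_difference_surj char0 al (- P) ga0.
pose t := Letter 1 1 0 H; set l := Letter _ _ _ _.
have vt : valid t by rewrite /valid /= oner_eq0.
apply: (@rigid_ext _ ((tri l \o tri t) \o tri (linv t))).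
  by move=> p /=; rewrite triVK.
apply: rigid_conj; first by apply: aut_tri; exact: valid_linv.
apply: (@rigid_ext _ (tri (Letter al 1 ga 0))); last first.
  by have [->|al1] := eqVneq al 1; [exact: rigid_translation | exact: rigid_scaled_translation].
suff e : tri t \o tri (Letter al 1 ga 0) =1 tri l \o tri t.
  by move=> p; rewrite -[LHS](triK vt); congr (tri _ _); exact: e.
apply: (@sub_ext _ (tri t \o tri (Letter al 1 ga 0)) (tri l \o tri t)) => /=.
  rewrite !triXE /triX /= !scale1r ev0 addr0 linearZ /= triXE /triX /= scale1r.
  rewrite rmorphD /= triXE tri_ev triYE /triX /triY /= scale1r.
  rewrite -addrA scalerDr; congr (_ + _).
  have := congr1 (fun Q => ev Q Y) eH; rewrite evB evZ ev_comp evD evX evC.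
  rewrite evN => /eqP; rewrite subr_eq => /eqP ->.
  by rewrite addrA subrr add0r.
rewrite !triYE /triY /= !scale1r mpolyC0 addr0 rmorphD /= triYE lrmorphC /triY /=.
by rewrite scale1r mpolyC0 addr0 triYE /triY /= scale1r.
Qed.
End RigidTriangular.

(** * Mixed radix expansions *)

Section MixedRadix.
Variables d E : nat -> nat.
Hypothesis E0 : (0 < E 0)%N.
Hypothesis ES : forall j, E j.+1 = (d j * E j)%N.
Implicit Types w : seq nat.

(** A word codes an expansion by its multiplicities: [i] occurs as often as its digit says, with
    radices [d] and place values [E]. *)
Definition radix_value w := (\sum_(i <- w) E i)%N.

Lemma radix_value_split m w : radix_value w =
  (count_mem m w * E m + radix_value [seq i <- w | i != m])%N.
Proof.
elim: w => [|i w IH]; first by rewrite /radix_value !big_nil.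
rewrite /radix_value /= big_cons -/(radix_value w) IH; case: eqP => [->|_] /=.
  by rewrite mulnDl mul1n addnA.
by rewrite big_cons -/(radix_value _) add0n addnCA.
Qed.

Lemma count_filter_neq m w i : i != m ->
  count_mem i [seq x <- w | x != m] = count_mem i w.
Proof.
move=> im; rewrite count_filter; apply: eq_count => x /=.
by case: eqP => // ->; rewrite im.
Qed.

Lemma normal_filter m w : (forall i, count_mem i w < d i)%N ->
  (forall i, count_mem i [seq x <- w | x != m] < d i)%N.
Proof.
move=> nw i; apply: leq_ltn_trans (nw i); rewrite count_filter.
by apply: sub_count => x /= /andP[].
Qed.

Lemma all_ltn_filter m w : all (ltn^~ m.+1) w -> all (ltn^~ m) [seq i <- w | i != m].
Proof.
move/allP => h; apply/allP => i; rewrite mem_filter => /andP[im /h] /=.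
by rewrite ltnS leq_eqVlt (negPf im).
Qed.

Lemma radix_value_lt m w : (forall i, count_mem i w < d i)%N ->
  all (ltn^~ m) w -> (radix_value w < E m)%N.
Proof.
elim: m w => [|m IH] w nw lw.
  by case: w nw lw => [|i w] // _ _; rewrite /radix_value big_nil.
rewrite (radix_value_split m).
have := IH _ (normal_filter m nw) (all_ltn_filter lw); rewrite ES; move: (nw m).
move: (count_mem m w) (radix_value _) => a b; clear; nia.
Qed.

Lemma radix_value_inj w w' : (forall i, count_mem i w < d i)%N ->
  (forall i, count_mem i w' < d i)%N -> radix_value w = radix_value w' -> perm_eq w w'.
Proof.
have [m lm] : exists m, all (ltn^~ m) w && all (ltn^~ m) w'.
  exists (\max_(i <- w ++ w') i).+1; rewrite -all_cat; apply/allP => i iw /=.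
  by rewrite ltnS; apply: (@leq_bigmax_seq _ _ predT id).
case/andP: lm; elim: m w w' => [|m IH] w w' lw lw' nw nw' e.
  by case: w lw {nw e} => [|i w] //; case: w' lw' {nw'}.
have ltr := radix_value_lt (normal_filter m nw) (all_ltn_filter lw).
have ltr' := radix_value_lt (normal_filter m nw') (all_ltn_filter lw').
move: e; rewrite (radix_value_split m w) (radix_value_split m w') => e.
(* Both remainders lie below [E m], so Euclidean division by [E m] determines the top digit and the
   remainder. *)
have [ec er] : count_mem m w = count_mem m w' /\
    radix_value [seq i <- w | i != m] = radix_value [seq i <- w' | i != m].
  move: e ltr ltr'; move: (count_mem m w) (count_mem m w') (radix_value _) (radix_value _).
  move=> a b x y; clear; case: (ltngtP a b) => [ab|ab|->] e1 e2 e3; last by split=> //; lia.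
    by exfalso; nia.
  by exfalso; nia.
have pr := IH _ _ (all_ltn_filter lw) (all_ltn_filter lw')
   (normal_filter m nw) (normal_filter m nw') er.
apply/allP => i _ /=; apply/eqP; have [->//|im] := eqVneq i m.
by rewrite -(count_filter_neq w im) -(count_filter_neq w' im); exact: (permP pr).
Qed.
End MixedRadix.

(** * Degree growth along a forward orbit *)

Section Forward.
Variable K : fieldType.
Local Notation T := {mpoly K[2]}.
Variables (u : int -> T) (Q : int -> {poly K}) (de : int -> K) (n : nat).
Variable rho : {lrmorphism T -> T}.
Hypothesis u_rec : forall j, u (j + 1) = ev (Q j) (u j) + de j *: u (j - 1).
Hypothesis Q_size : forall j, (2 < size (Q j))%N.
Hypothesis Q_per : forall j, size (Q (j + n%:Z)) = size (Q j).
Hypothesis deg_u0 : (0 < deg (u 0))%N.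
Hypothesis deg_uN1 : (deg (u (-1)) <= deg (u 0))%N.
Hypothesis n_gt0 : (0 < n)%N.
Hypothesis rho_u : forall j, rho (u j) = u (j + n%:Z).

(** The polynomial term dominates the recurrence because Q_k has degree at least 2. The degrees of
    the Q_k thus become radices with place values [deg (u k)]. *)
Lemma deg_u_step (k : nat) : [/\ (0 < deg (u k))%N, (deg (u (k%:Z - 1)) <= deg (u k))%N &
  deg (u k.+1) = ((size (Q k)).-1 * deg (u k))%N].
Proof.
have step (j : nat) : (0 < deg (u j))%N -> (deg (u (j%:Z - 1)) <= deg (u j))%N ->
    deg (u j.+1) = ((size (Q j)).-1 * deg (u j))%N.
  move=> g0 le; have -> : (j.+1 : int) = j%:Z + 1 by rewrite -addn1 PoszD.
  have Qj : Q j != 0 by rewrite -size_poly_gt0; apply: leq_ltn_trans (Q_size j).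
  have [_ de1] := deg_ev g0 Qj.
  rewrite u_rec addrC degDr // de1; apply: leq_ltn_trans (degZ_le _ _) _.
  apply: leq_ltn_trans le _; move: (Q_size j) g0; clear.
  by move: (size _) (deg _) => a b; nia.
elim: k => [|k [g0 le e]]; first by split=> //; apply: step.
have g1 : (0 < deg (u k.+1))%N.
  by rewrite e muln_gt0 g0 andbT; move: (Q_size k); clear; case: (size _) => [|[|a]].
have le1 : (deg (u (k.+1%:Z - 1)) <= deg (u k.+1))%N.
  have -> : k.+1%:Z - 1 = k%:Z by rewrite -addn1 PoszD addrK.
  by rewrite e; move: (Q_size k); clear; move: (size _) (deg _) => a b; nia.
by split=> //; apply: step.
Qed.

Lemma deg_u_gt (k : nat) : (k < deg (u k))%N.
Proof.
elim: k => [|k IH]; first exact: deg_u0.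
have [_ _ ->] := deg_u_step k; move: (Q_size k) IH; clear.
by move: (size _) (deg _) => a b; nia.
Qed.

Lemma deg_u_double (i j : nat) : (i < j)%N -> (2 * deg (u i) <= deg (u j))%N.
Proof.
elim: j => [//|j IH]; rewrite ltnS leq_eqVlt => /orP[/eqP ->|/IH le].
  by have [_ _ ->] := deg_u_step j; rewrite leq_mul2r; move: (Q_size j); clear; case: (size _) => [|[|[|a]]]; rewrite ?orbT.
apply: leq_trans le _; have [_ _ ->] := deg_u_step j; move: (Q_size j); clear.
by move: (size _) (deg _) => a b; nia.
Qed.

Definition word_mon (w : seq int) : T := \prod_(i <- w) u i.

Lemma iter_rho_word k w : iter k rho (word_mon w) = word_mon [seq i + (k * n)%N%:Z | i <- w].
Proof.
elim: k => [|k IH] /=.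
  by rewrite mul0n; congr word_mon; rewrite -[LHS]map_id; apply: eq_map => i; rewrite addr0.
rewrite IH /word_mon rmorph_prod !big_map; apply: eq_bigr => i _.
by rewrite /= rho_u -addrA -PoszD; congr (u (_ + Posz _)); rewrite mulSn addnC.
Qed.

Lemma Q_per_iter k j : size (Q (j + (k * n)%N%:Z)) = size (Q j).
Proof.
elim: k => [|k IH]; first by rewrite mul0n addr0.
by rewrite mulSn addnC PoszD addrA Q_per.
Qed.

Lemma deg_word_mon (w : seq nat) :
  word_mon [seq Posz i | i <- w] != 0 /\
  deg (word_mon [seq Posz i | i <- w]) = radix_value (fun i => deg (u i)) w.
Proof.
elim: w => [|i w [IH0 IH]].
  by rewrite /word_mon /radix_value !big_nil -mpolyC1 degC mpolyC_eq0 oner_eq0.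
have [g0 _ _] := deg_u_step i; have ui := deg_gt0_neq0 g0.
rewrite /word_mon /radix_value /= !big_cons -/(word_mon _) -/(radix_value _ _).
by rewrite mulf_neq0 // degM // IH.
Qed.

(** After enough iterations of [rho] all indices are nonnegative, and normal words have distinct
    degrees by uniqueness of the expansion. No monomial can then exceed the degree allowed to [h].
    The index type [I] lets the same terms be reused with reflected words. *)
Lemma forward_bound (I : eqType) (r : seq I) (c : I -> K) (W : I -> seq int) h c0 C :
  uniq r -> (forall i, i \in r -> c i != 0) ->
  (forall i, i \in r -> forall j, count_mem j (W i) < (size (Q j)).-1)%N ->
  {in r &, forall i i', perm_eq (W i) (W i') -> i = i'} ->
  h = \sum_(i <- r) c i *: word_mon (W i) ->
  (forall k, deg (iter k rho h) <= deg (iter k rho (u c0)) + C)%N ->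
  forall i, i \in r -> (forall j, j \in W i -> j <= c0) /\ (count_mem c0 (W i) <= 1)%N.
Proof.
move=> ur cnz nW pW eh bnd i0 i0r.
have [M leM] : exists M, forall i j, i \in r -> j \in W i -> (`|j| <= M)%N.
  exists (\sum_(i <- r) \sum_(j <- W i) `|j|)%N => i j ir jW.
  by rewrite (big_rem i) //= (big_rem j) //= -addnA leq_addr.
(* M makes all shifted indices nonnegative; |c0| and C make the shifted c0 at least C, so that u
   there has degree above C. *)
have [k ltk] : exists k, (M + `|c0| + C < k)%N by exists (M + `|c0| + C).+1.
have lekn : (k <= k * n)%N by rewrite leq_pmulr.
have big_idx i j : i \in r -> j \in W i -> 0 <= j + (k * n)%N%:Z.
  move=> ir jW; move: (leM i j ir jW) lekn ltk; move: (k * n)%N; clear; lia.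
have c0k : (C%:Z <= c0 + (k * n)%N%:Z).
  by move: lekn ltk; move: (k * n)%N; clear; lia.
pose sh i := [seq absz (j + (k * n)%N%:Z) | j <- W i].
have shE i : i \in r -> [seq Posz a | a <- sh i] = [seq j + (k * n)%N%:Z | j <- W i].
  move=> ir; rewrite /sh -map_comp; apply/eq_in_map => j jW /=.
  by rewrite gez0_abs // (big_idx i).
have count_sh i a : i \in r -> count_mem a (sh i) = count_mem (a%:Z - (k * n)%N%:Z) (W i).
  move=> ir; rewrite /sh count_map; apply: eq_in_count => j jW /=.
  have := big_idx i j ir jW; move: (k * n)%N => x h1.
  by apply/eqP/eqP => e; move: h1 e; clear; lia.
have nsh i : i \in r -> forall a, (count_mem a (sh i) < (size (Q a)).-1)%N.
  move=> ir a; rewrite count_sh //; have := nW i ir (a%:Z - (k * n)%N%:Z).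
  by rewrite -(Q_per_iter k) subrK.
have valE i : i \in r -> deg (iter k rho (c i *: word_mon (W i))) =
    radix_value (fun a => deg (u a)) (sh i).
  move=> ir; have -> : iter k rho (c i *: word_mon (W i)) = c i *: iter k rho (word_mon (W i)).
    by elim: (k) => //= k' ->; rewrite linearZ.
  rewrite degZ ?cnz // iter_rho_word -shE //.
  by have [_ ->] := deg_word_mon (sh i).
have ES j : deg (u j.+1) = ((size (Q j)).-1 * deg (u j))%N.
  by have [_ _] := deg_u_step j.
have U : uniq [seq deg (iter k rho (c i *: word_mon (W i))) | i <- r].
  rewrite map_inj_in_uniq // => i i' ir i'r; rewrite valE // valE // => e.
  have := @radix_value_inj (fun a => (size (Q (Posz a))).-1) (fun a => deg (u (Posz a)))
    deg_u0 ES _ _ (nsh i ir) (nsh i' i'r) e.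
  move=> /(perm_map Posz); rewrite !shE // => /(perm_map (fun j => j - (k * n)%N%:Z)).
  rewrite -!map_comp.
  have idm w : [seq ((fun j => j - (k * n)%N%:Z) \o +%R^~ (k * n)%N%:Z) i | i <- w] = w.
    by rewrite -[RHS]map_id; apply: eq_map => j /=; rewrite addrK.
  by rewrite !idm; exact: pW.
have := val_sum_distinct (@deg0 K) (@degN K) (@degD_le K) U i0r.
have -> : \sum_(j <- r) iter k rho (c j *: word_mon (W j)) = iter k rho h.
  rewrite eh; elim: (k) => //= k' IH; rewrite -IH rmorph_sum /=.
  by apply: eq_bigr.
rewrite valE // => le.
have iter_u m : iter m rho (u c0) = u (c0 + (m * n)%N%:Z).
  have := iter_rho_word m [:: c0]; rewrite /word_mon /= !big_cons !big_nil !mulr1.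
  exact.
have {le bnd} le := leq_trans le (bnd k).
have [a ea] : exists a : nat, c0 + (k * n)%N%:Z = a.
  by exists (absz (c0 + (k * n)%N%:Z)); rewrite gez0_abs //; move: c0k; clear; lia.
rewrite iter_u ea in le; rewrite ea in c0k.
have ltC : (C < deg (u a))%N by apply: leq_ltn_trans (deg_u_gt a).
have mem_le b s : b \in s -> (deg (u (Posz b)) <= radix_value (fun a => deg (u (Posz a))) s)%N.
  by move=> bs; rewrite /radix_value (big_rem b) //= leq_addr.
split=> [j jW|].
  (* An index beyond c0 contributes at least twice [deg (u a)], more than [deg (u a) + C]; below,
     two copies of c0 do the same. *)
  rewrite Order.TotalTheory.leNgt; apply/negP => lt.
  have jb : absz (j + (k * n)%N%:Z) \in sh i0 by apply: map_f.
  have := mem_le _ _ jb; have lta : (a < absz (j + (k * n)%N%:Z)%R)%N.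
    by move: lt ea; move: (k * n)%N; clear; lia.
  have := deg_u_double lta; move: le ltC; move: (radix_value _ _) (deg _) (deg _); clear; lia.
rewrite leqNgt; apply/negP => lt.
have := radix_value_split (fun a => deg (u (Posz a))) a (sh i0).
rewrite count_sh // -ea addrK => e.
move: le ltC lt; rewrite e ea; move: (count_mem _ _) (deg _) (radix_value _ _); clear.
by move=> x y z; nia.
Qed.
End Forward.

(** * Normal forms in orbit coordinates and the two-sided bound *)

Section TwoSided.
Variable K : fieldType.
Local Notation T := {mpoly K[2]}.
Implicit Types (h : T) (w : seq int).
Variables (u : int -> T) (Q : int -> {poly K}) (de : int -> K) (n : nat).
Variables rho rho' : {lrmorphism T -> T}.
Hypothesis u_rec : forall j, u (j + 1) = ev (Q j) (u j) + de j *: u (j - 1).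
Hypothesis de_neq0 : forall j, de j != 0.
Hypothesis Q_size : forall j, (2 < size (Q j))%N.
Hypothesis Q_per : forall j, size (Q (j + n%:Z)) = size (Q j).
Hypothesis u0E : u 0 = mY K.
Variables e0 e1 : K.
Hypothesis e0_neq0 : e0 != 0.
Hypothesis uN1E : mX K = e0 *: u (-1) + e1%:MP.
Hypothesis n_gt0 : (0 < n)%N.
Hypothesis rho_u : forall j, rho (u j) = u (j + n%:Z).
Hypothesis rhoK : cancel rho rho'.
Hypothesis rhoVK : cancel rho' rho.

Let dg j := (size (Q j)).-1.
Definition normal w := all (fun j => count_mem j w < dg j)%N w.

Lemma dg_gt1 j : (1 < dg j)%N.
Proof. by rewrite /dg; move: (Q_size j); case: (size _) => [|[|[|]]]. Qed.

Lemma normalP w : normal w -> forall j, (count_mem j w < dg j)%N.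
Proof.
move/allP => nw j; have [/nw //|jw] := boolP (j \in w).
by rewrite (count_memPn jw); exact: leq_trans (dg_gt1 j).
Qed.

Definition spanned (A : seq int -> bool) h := exists2 ts : seq (K * seq int),
  all (fun t => A t.2) ts & h = \sum_(t <- ts) t.1 *: word_mon u t.2.

Lemma spannedD A h h' : spanned A h -> spanned A h' -> spanned A (h + h').
Proof.
move=> [ts a ->] [ts' a' ->]; exists (ts ++ ts'); first by rewrite all_cat a.
by rewrite big_cat.
Qed.

Lemma spanned0 A : spanned A 0.
Proof. by exists [::] => //; rewrite big_nil. Qed.

Lemma spannedZ A c h : spanned A h -> spanned A (c *: h).
Proof.
move=> [ts a ->]; exists [seq (c * t.1, t.2) | t <- ts]; first by rewrite all_map.
by rewrite big_map scaler_sumr; apply: eq_bigr => t _; rewrite scalerA.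
Qed.

Lemma spanned_sum A (I : eqType) (r : seq I) (F : I -> T) :
  (forall i, i \in r -> spanned A (F i)) -> spanned A (\sum_(i <- r) F i).
Proof.
move=> h; rewrite big_seq; elim/big_ind: _ => //; first exact: spanned0.
exact: spannedD.
Qed.

Lemma spanned_word (A : seq int -> bool) w : A w -> spanned A (word_mon u w).
Proof. by exists [:: (1, w)]; rewrite /= ?andbT // big_seq1 scale1r. Qed.

Lemma word_mon_cat w w' : word_mon u (w ++ w') = word_mon u w * word_mon u w'.
Proof. exact: big_cat. Qed.

Lemma word_mon_perm w w' : perm_eq w w' -> word_mon u w = word_mon u w'.
Proof. by move=> p; apply: perm_big. Qed.

Lemma word_mon_nseq k j : word_mon u (nseq k j) = u j ^+ k.
Proof. by rewrite /word_mon big_nseq iter_mulr_1. Qed.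

Lemma ev_top (P : {poly K}) (q : T) : (0 < size P)%N -> lead_coef P *: q ^+ (size P).-1 =
  ev P q - \sum_(i < (size P).-1) P`_i *: q ^+ i.
Proof.
move=> sP; have -> : ev P q = \sum_(i < size P) P`_i *: q ^+ i.
  rewrite -{1}[P]coefK poly_def /ev rmorph_sum /=; apply: eq_bigr => i _.
  by rewrite -/(ev _ _) evZ evXn.
rewrite lead_coefE; case: (size P) sP => // m _.
by rewrite big_ord_recr /= addrAC subrr add0r.
Qed.

(** An excessive power of u_j is rewritten by the recurrence into u_(j+1), u_(j-1) and lower powers
    of u_j. Every resulting word is shorter, as the replaced power has length at least 2. *)
Lemma normal_span w : spanned normal (word_mon u w).
Proof.
have [m] := ubnP (size w); elim: m w => // m IH w ltw.
have [nw|] := boolP (normal w); first exact: spanned_word.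
rewrite -has_predC => /hasP[j jw /=]; rewrite -leqNgt => lej.
(* The word left after taking [dg j] copies of [j] out of [w]. *)
pose v := nseq (count_mem j w - dg j) j ++ [seq x <- w | x != j].
have pw : perm_eq w (nseq (dg j) j ++ v).
  apply/permP => a; rewrite /v !count_cat addnA !count_nseq -mulnDr subnKC //.
  elim: (w) => [|x s IHs] /=; first by rewrite muln0.
  by rewrite IHs; case: eqP => [->|_] /=; lia.
have sv : (size w = dg j + size v)%N by rewrite (perm_size pw) size_cat size_nseq.
have g1 := dg_gt1 j.
have szlt : ((size v).+1 < m)%N.
  by move: ltw g1; rewrite sv; move: (dg j) (size v); clear; lia.
have sQ : (0 < size (Q j))%N by move: (Q_size j); case: (size _).
have lQ : lead_coef (Q j) != 0 by rewrite lead_coef_eq0 -size_poly_gt0.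
have -> : word_mon u w = (lead_coef (Q j))^-1 *: (lead_coef (Q j) *: word_mon u w).
  by rewrite scalerA mulVf // scale1r.
apply: spannedZ; rewrite (word_mon_perm pw) word_mon_cat word_mon_nseq scalerAl.
rewrite ev_top // mulrBl.
have -> : ev (Q j) (u j) = u (j + 1) - de j *: u (j - 1) by rewrite u_rec addrK.
have wc i : word_mon u (i :: v) = u i * word_mon u v by rewrite /word_mon big_cons.
rewrite mulrBl -scalerAl -!wc mulr_suml; apply: spannedD.
  apply: spannedD; first by apply: IH; exact: szlt.
  by rewrite -scaleNr; apply: spannedZ; apply: IH; exact: szlt.
rewrite -scaleN1r; apply: spannedZ; apply: spanned_sum => i _.
rewrite -scalerAl; apply: spannedZ; rewrite -word_mon_nseq -word_mon_cat.
apply: IH; rewrite size_cat size_nseq.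
by move: (ltn_ord i) ltw; rewrite sv -/(dg j) ltnS => h1 h2; apply: leq_trans h2; rewrite ltn_add2r.
Qed.

Lemma all_spanned h : spanned xpredT h.
Proof.
move: h; apply: mpoly2_ind => [c|||p q|p q [ts _ ->] [ts' _ ->]].
- exists [:: (c, [::])] => //.
  by rewrite big_seq1 /word_mon big_nil -mul_mpolyC mulr1.
- exists [:: (e0, [:: -1]); (e1, [::])] => //.
  by rewrite big_cons big_seq1 /word_mon big_seq1 big_nil uN1E -[e1 *: 1]mul_mpolyC mulr1.
- by exists [:: (1, [:: 0])] => //; rewrite big_seq1 /word_mon big_seq1 scale1r u0E.
- exact: spannedD.
- rewrite mulr_suml; apply: spanned_sum => t _.
  rewrite mulr_sumr; apply: spanned_sum => t' _.
  rewrite -scalerAl -scalerAr -word_mon_cat; do 2!apply: spannedZ.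
  exact: spanned_word.
Qed.

Lemma normal_spanned h : spanned normal h.
Proof.
have [ts _ ->] := all_spanned h; apply: spanned_sum => t _.
by apply: spannedZ; apply: normal_span.
Qed.

Lemma normal_perm w w' : perm_eq w w' -> normal w = normal w'.
Proof.
move=> p; rewrite /normal (perm_all _ p); apply: eq_all => j.
by rewrite (permP p).
Qed.

Lemma normal_form h : exists (ws : seq (seq int)) (c : seq int -> K),
  [/\ uniq ws, forall w, w \in ws -> c w != 0, forall w, w \in ws -> normal w,
      {in ws &, forall w w', perm_eq w w' -> w = w'} &
      h = \sum_(w <- ws) c w *: word_mon u w].
Proof.
have [ts nts ->] := normal_spanned h.
(* Sorting picks one word per multiset, so terms with the same monomial can be merged. *)
pose key (t : K * seq int) := sort <=%O t.2.
pose c w := \sum_(t <- ts | key t == w) t.1.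
exists [seq w <- undup [seq key t | t <- ts] | c w != 0], c; split.
- by rewrite filter_uniq // undup_uniq.
- by move=> w; rewrite mem_filter => /andP[].
- move=> w; rewrite mem_filter mem_undup => /andP[_ /mapP[t tts ->]].
  rewrite (@normal_perm _ t.2) ?perm_sort //; exact: (allP nts).
- move=> w w'; rewrite !mem_filter !mem_undup => /andP[_ /mapP[t _ ->]] /andP[_ /mapP[t' _ ->]].
  rewrite /key => p; apply/Order.TotalTheory.perm_sort_leP.
  by rewrite perm_sym perm_sort perm_sym in p; rewrite perm_sort in p.
rewrite big_filter [RHS]big_mkcond /=.
transitivity (\sum_(w <- undup [seq key t | t <- ts]) c w *: word_mon u w); last first.
  by apply: eq_bigr => w _; case: eqP => // ->; rewrite scale0r.
rewrite /c; under [RHS]eq_bigr => w _ do rewrite scaler_suml.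
rewrite (exchange_big_dep xpredT) //= big_seq [RHS]big_seq; apply: eq_bigr => t tts.
have kt : key t \in undup [seq key t | t <- ts] by rewrite mem_undup map_f.
rewrite -big_filter (_ : filter _ _ = [:: key t]); last first.
  by rewrite -(filter_pred1_uniq (undup_uniq _) kt); apply: eq_filter => w /=; rewrite eq_sym.
by rewrite big_seq1; congr (_ *: _); apply: word_mon_perm; rewrite perm_sym perm_sort.
Qed.

Lemma deg_der (D : T -> T) : is_derivation D ->
  exists C, forall h, (deg (D h) <= deg h + C)%N.
Proof.
move=> dD; exists (maxn (deg (D (mX K))) (deg (D (mY K)))) => h.
rewrite (der_partial dD h); apply: leq_trans (degD_le _ _) _.
rewrite geq_max; apply/andP; split; apply: leq_trans (degM_le _ _) _; apply: leq_add.
- exact: deg_mderiv.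
- exact: leq_maxl.
- exact: deg_mderiv.
- exact: leq_maxr.
Qed.

Lemma deg_u0E : deg (u 0) = 1%N. Proof. by rewrite u0E degY. Qed.
Lemma deg_uN1E : deg (u (-1)) = 1%N.
Proof.
have -> : u (-1) = e0^-1 *: (- e1%:MP + mX K).
  by rewrite uN1E addrC addrK scalerA mulVf // scale1r.
by rewrite degZ ?invr_eq0 // degDr ?degX // degN degC.
Qed.

(** The reflection exchanges u_0 and u_(-1), both of degree 1. Reflecting about 0 would put u_1 at
    index -1, whose degree exceeds that of u_0, against the starting condition of the forward
    argument. *)
Let u' j := u (-1 - j).

Lemma der_u0_linear (D : T -> T) : is_derivation D ->
  (forall f, rho (D f) = D (rho f)) ->
  exists la mu, D (u 0) = la *: u 0 + mu%:MP.
Proof.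
move=> dD comm; have [C degC'] := deg_der dD.
have comm' f : rho' (D f) = D (rho' f).
  by apply: (can_inj rhoK); rewrite rhoVK comm rhoVK.
have [ws [c [uws cn0 nws pws eD]]] := normal_form (D (u 0)).
have bnd k : (deg (iter k rho (D (u 0))) <= deg (iter k rho (u 0)) + C)%N.
  suff -> : iter k rho (D (u 0)) = D (iter k rho (u 0)) by [].
  by elim: k => //= k ->; rewrite comm.
(* In the reversed indexing u_0 carries the index -1, so the backward bound is taken there. *)
have bnd' k : (deg (iter k rho' (D (u 0))) <= deg (iter k rho' (u' (-1))) + C)%N.
  have -> : u' (-1) = u 0 by rewrite /u' subrr.
  suff -> : iter k rho' (D (u 0)) = D (iter k rho' (u 0)) by [].
  by elim: k => //= k ->; rewrite comm'.
have fw := forward_bound u_rec Q_size Q_per _ _ n_gt0 rho_u uws cn0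
  (fun w ww => normalP (nws w ww)) pws eD bnd.
rewrite deg_u0E deg_uN1E in fw; have {}fw := fw isT isT.
(* Obtained by solving the recurrence for u_(j-1). *)
pose Q' j := - (de (-1 - j))^-1 *: Q (-1 - j).
pose de' j := (de (-1 - j))^-1.
have u'_rec j : u' (j + 1) = ev (Q' j) (u' j) + de' j *: u' (j - 1).
  rewrite /u' /Q' /de'; have := u_rec (-1 - j).
  have -> : -1 - j + 1 = -1 - (j - 1) by ring.
  have -> : -1 - j - 1 = -1 - (j + 1) by ring.
  move=> ->; rewrite evZ scaleNr scalerDr addrA addNr add0r.
  by rewrite scalerA mulVf // scale1r.
have szQ' j : size (Q' j) = size (Q (-1 - j)).
  by rewrite /Q' size_scale // oppr_eq0 invr_eq0.
have Q'_size j : (2 < size (Q' j))%N by rewrite szQ'.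
have Q'_per j : size (Q' (j + n%:Z)) = size (Q' j).
  rewrite !szQ' -(@Q_per (-1 - (j + n%:Z))).
  by congr (size (Q _)); ring.
have rho'_u j : rho' (u' j) = u' (j + n%:Z).
  apply: (can_inj rhoK); rewrite rhoVK /u' rho_u; congr u; ring.
have rr (j : int) : -1 - (-1 - j) = j by ring.
have eD' : D (u 0) = \sum_(w <- ws) c w *: word_mon u' [seq -1 - j | j <- w].
  rewrite eD; apply: eq_bigr => w _; congr (_ *: _).
  by rewrite /word_mon big_map; apply: eq_bigr => j _; rewrite /u' rr.
have pws' : {in ws &, forall w w', perm_eq [seq -1 - j | j <- w] [seq -1 - j | j <- w'] -> w = w'}.
  move=> w w' iw iw' /(perm_map (fun j => -1 - j)); rewrite -!map_comp.
  have idm (v : seq int) : [seq ((fun j : int => -1 - j) \o (fun j : int => -1 - j)) i | i <- v] = v.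
    by rewrite -[RHS]map_id; apply: eq_map => j; exact: rr.
  by rewrite !idm; exact: pws.
have nws' w : w \in ws -> forall j, (count_mem j [seq (-1 - i)%R | i <- w] < (size (Q' j)).-1)%N.
  move=> iw j; rewrite szQ'; apply: leq_ltn_trans (normalP (nws w iw) (-1 - j)).
  by rewrite count_map; apply: sub_count => x /= /eqP <-; apply/eqP; rewrite rr.
have bw := forward_bound u'_rec Q'_size Q'_per _ _ n_gt0 rho'_u uws cn0 nws' pws' eD' bnd'.
rewrite {1 2 3}/u' subr0 subrr deg_u0E deg_uN1E in bw; have {}bw := bw isT isT.
have only w : w \in ws -> w = [::] \/ w = [:: 0].
  move=> iw; have [f1 f2] := fw w iw; have [b1 _] := bw w iw.
  have z j : j \in w -> j = 0.
    move=> jw; have := f1 j jw; have := b1 (-1 - j) (map_f _ jw); clear; lia.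
  have ew : w = nseq (size w) 0 by apply/all_pred1P/allP => j /z ->; rewrite /= eqxx.
  move: f2; rewrite {1}ew count_nseq /= mul1n ew size_nseq.
  by case: (size w) => [|[|]] //; [left | right].
rewrite {1}eD big_seq; elim/big_ind: _ => [|p q [la [mu ->]] [la' [mu' ->]]|w /only].
- by exists 0, 0; rewrite scale0r mpolyC0 addr0.
- by exists (la + la'), (mu + mu'); rewrite scalerDl mpolyCD addrACA.
case=> ->; rewrite /word_mon ?big_seq1 ?big_nil.
  by exists 0, (c [::]); rewrite scale0r add0r -mul_mpolyC mulr1.
by exists (c [:: 0]), 0; rewrite mpolyC0 addr0.
Qed.

(** From D u_0 = la u_0 + mu with la nonzero, the curve is u_0 + mu / la. If la = 0, then D u_0 is
    constant, so D kills u_n - u_0, which is not constant since u_n has degree at least 2. *)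
Lemma rigid_two_sided : rigid rho.
Proof.
move=> D dD sD comm; exfalso.
have [la [mu e]] := der_u0_linear dD comm.
have [la0|la0] := eqVneq la 0; last first.
  apply: (@simple_no_darboux K D dD sD (u 0 + (mu / la)%:MP) la%:MP).
    rewrite (der_add dD) (derC dD) addr0 e mulrDr mul_mpolyC -mpolyCM.
    by rewrite mulrC divfK.
  by rewrite addrC degDr ?deg_u0E // degC.
rewrite la0 scale0r add0r in e.
apply: (@simple_no_darboux K D dD sD (- u 0 + rho (u 0)) 0).
  by rewrite (der_add dD) (derN dD) -comm e lrmorphC addNr mul0r.
have lt : (1 < deg (u n))%N.
  have := @deg_u_double K u Q de u_rec Q_size _ _ 0 n n_gt0.
  by rewrite deg_u0E deg_uN1E; apply.
by rewrite rho_u add0r degDr ?degN ?deg_u0E // ltnW.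
Qed.
End TwoSided.

(** * Henon words and their orbits *)

Section HenonWords.
Variable K : fieldType.
Local Notation T := {mpoly K[2]}.
Implicit Types (p q f g h : T) (P Q : {poly K}) (l : letter K) (ls : seq (letter K)).
Local Notation X := (mX K).
Local Notation Y := (mY K).

Definition henon l : T -> T := tri l \o @swp K.
Definition henon_inv l : T -> T := @swp K \o tri (linv l).

Lemma henX l : henon l X = triY l.
Proof. by rewrite -[LHS]/(tri l (swp X)) swpX triYE. Qed.
Lemma henY l : henon l Y = triX l.
Proof. by rewrite -[LHS]/(tri l (swp Y)) swpY triXE. Qed.
Lemma henK l : valid l -> cancel (henon l) (henon_inv l).
Proof. by move=> vl p; rewrite /henon /henon_inv /= triK // swpK. Qed.
Lemma heniK l : valid l -> cancel (henon_inv l) (henon l).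
Proof. by move=> vl p; rewrite /henon /henon_inv /= swpK triVK. Qed.
Lemma aut_hen l : valid l -> is_Kalg_automorphism (henon l).
Proof. by move=> vl; apply: aut_comp; [exact: aut_tri | exact: aut_swp]. Qed.
Lemma aut_heni l : valid l -> is_Kalg_automorphism (henon_inv l).
Proof.
by move=> vl; apply: aut_comp; [exact: aut_swp | apply: aut_tri; exact: valid_linv].
Qed.

Lemma tri_hen l l' p : tri l (henon l' p) = henon (lmul l l') p.
Proof. by rewrite -[LHS]/(tri l (tri l' (swp p))) tri_lmul. Qed.

Lemma hen_lid p : henon (lid K) p = swp p.
Proof. by rewrite -[LHS]/(tri (lid K) (swp p)) tri_lid. Qed.

HB.instance Definition _ l := GRing.LRMorphism.copy (henon l) (tri l \o @swp K).

(* Keeps unification from unfolding these maps down to [mmap]. *)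
#[local] Opaque henon henon_inv tri swp.

Fixpoint henon_word ls p : T := if ls is l :: ls' then henon l (henon_word ls' p) else p.

Lemma cw_cat ls ls' p : henon_word (ls ++ ls') p = henon_word ls (henon_word ls' p).
Proof. by elim: ls => [|l ls IH]; [| exact: (congr1 (henon l) IH)]. Qed.

Lemma aut_cw ls : all (@valid K) ls -> is_Kalg_automorphism (henon_word ls).
Proof.
elim: ls => [_|l ls IH /= /andP[vl vls]]; first exact: aut_id.
by apply: aut_comp; [exact: aut_hen | exact: IH].
Qed.

Section Orbit.
Variable L : int -> letter K.
Hypothesis vL : forall j, valid (L j).

(** Letters are appended on the right, so that psi_(j+1) = psi_j o henon (L j) for all integers j
    and y is sent to u_j. Since [Negz k] is - k - 1, it takes k + 1 inverse letters. *)
Fixpoint psi_pos (k : nat) : T -> T :=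
  if k is k'.+1 then psi_pos k' \o henon (L k') else id.
Fixpoint psi_neg (k : nat) : T -> T :=
  if k is k'.+1 then psi_neg k' \o henon_inv (L (Negz k')) else id.
Definition psi (j : int) : T -> T :=
  match j with Posz k => psi_pos k | Negz k => psi_neg k.+1 end.

Lemma psiS j : psi (j + 1) =1 psi j \o henon (L j).
Proof.
case: j => [k|[|k]] p.
- by have -> : k%:Z + 1 = k.+1 by rewrite -PoszD addn1.
- by rewrite /psi /= henK.
- have -> : Negz k.+1 + 1 = Negz k by lia.
  by rewrite /psi /= henK.
Qed.

Lemma aut_psi j : is_Kalg_automorphism (psi j).
Proof.
case: j => k; rewrite /psi.
  elim: k => [|k IH]; first exact: aut_id.
  by apply: aut_comp => //; exact: aut_hen.
elim: k.+1 => [|k' IH]; first exact: aut_id.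
by apply: aut_comp => //; exact: aut_heni.
Qed.

Lemma aut_lin (rho : T -> T) c p d : is_Kalg_automorphism rho ->
  rho (c *: p + d%:MP) = c *: rho p + d%:MP.
Proof. by move=> a; have [-> _ _ _] := a; rewrite autC. Qed.

Lemma aut_ev (rho : T -> T) P q : is_Kalg_automorphism rho ->
  rho (ev P q) = ev P (rho q).
Proof. by move=> a; rewrite (autE a (ev P q)) sub_ev -(autE a q). Qed.

Definition orb j := psi j Y.

Lemma psiX j : psi (j + 1) X = l_be (L j) *: orb j + (l_ga (L j))%:MP.
Proof. by rewrite psiS /= henX /triY aut_lin //; exact: aut_psi. Qed.

(** A Henon map sends x to be y + ga, so psi_j x is affine in u_(j-1); its constant is absorbed into
    the polynomial in u_j. *)
Lemma orb_rec j : orb (j + 1) =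
  ev (l_P (L j) + (l_al (L j) * l_ga (L (j - 1)))%:P) (orb j) +
  (l_al (L j) * l_be (L (j - 1))) *: orb (j - 1).
Proof.
rewrite {1}/orb psiS /= henY /triX; have [-> _ _ _] := aut_psi j.
rewrite aut_ev; last exact: aut_psi.
have := psiX (j - 1); rewrite subrK => ->.
rewrite evD evC -/(orb j) scalerDr scalerA -[_ *: _%:MP]mul_mpolyC -mpolyCM.
rewrite -addrA addrC; congr (_ + _).
by rewrite addrC.
Qed.
End Orbit.

Lemma rigid_henon ls : (0 < size ls)%N -> all (@valid K) ls ->
  all (fun l => 2 < size (l_P l))%N ls -> rigid (henon_word ls).
Proof.
move=> + vls sls; set n := size ls => n0.
have nz : n%:Z != 0 by rewrite eqz_nat -lt0n.
(* The n-periodic extension of the word; periodicity makes composition with the whole word shift the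
   orbit by n. *)
pose L (j : int) := nth (lid K) ls (absz (j %% n%:Z)%Z).
have idx j : (absz (j %% n%:Z)%Z < n)%N.
  by have := modz_ge0 j nz; have := ltz_pmod j (d := n%:Z) n0; lia.
have vL j : valid (L j) by apply: (all_nthP _ vls).
have sL j : (2 < size (l_P (L j)))%N by apply: (all_nthP _ sls).
have Lper j : L (j + n%:Z) = L j by rewrite /L modzDr.
have psi_cw k : (k <= n)%N -> psi_pos L k =1 henon_word (take k ls).
  elim: k => [_ p|k IH ltk p]; first by rewrite take0.
  rewrite (take_nth (lid K) ltk) -cats1 (cw_cat (take k ls)) -(IH (ltnW ltk)).
  have eL : nth (lid K) ls k = L k by rewrite /L modz_small.
  by rewrite eL.
have rho_psi j p : henon_word ls (psi L j p) = psi L (j + n%:Z) p.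
  (* An equivalence, so that it serves both directions of the induction over the integers. *)
  have up i q : henon_word ls (psi L i (henon (L i) q)) = psi L (i + n%:Z) (henon (L i) q) <->
      henon_word ls (psi L (i + 1) q) = psi L (i + 1 + n%:Z) q.
    by rewrite psiS // addrAC psiS // Lper.
  elim/int_rect: j p => [|k IH|k IH] p.
  - by rewrite add0r -[psi L 0 p]/p -[psi L n p]/(psi_pos L n p) psi_cw // take_size.
  - have -> : k.+1%:Z = k%:Z + 1 by rewrite -addn1 PoszD.
    by apply/up; exact: IH.
  - rewrite -[p](heniK (vL (- k.+1%:Z))); apply/up.
    have -> : - k.+1%:Z + 1 = - k%:Z by lia.
    exact: IH.
have arho := aut_cw vls; have [rho' [arho' c1 c2]] := aut_inv arho.
have Qsz j : size (l_P (L j) + (l_al (L j) * l_ga (L (j - 1)))%:P) = size (l_P (L j)).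
  by rewrite size_polyDl // size_polyC; apply: leq_ltn_trans (leq_b1 _) (ltnW (sL j)).
apply: (@rigid_ext _ (sub (henon_word ls X) (henon_word ls Y))); first by move=> p; rewrite -autE.
apply: (@rigid_two_sided _ (orb L)
  (fun j => l_P (L j) + (l_al (L j) * l_ga (L (j - 1)))%:P)
  (fun j => l_al (L j) * l_be (L (j - 1))) n
  (sub (henon_word ls X) (henon_word ls Y)) (sub (rho' X) (rho' Y)) (orb_rec vL)
  _ _ _ _ (l_be (L (-1))) (l_ga (L (-1)))) => //=.
- by move=> j; rewrite mulf_neq0 //; [case/andP: (vL j) | case/andP: (vL (j - 1))].
- by move=> j; rewrite Qsz.
- by move=> j; rewrite !Qsz Lper.
- by case/andP: (vL (-1)).
- by rewrite -(psiX vL (-1)).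
- by move=> j; rewrite -autE // rho_psi.
- by move=> p; rewrite -(autE arho) -(autE arho').
- by move=> p; rewrite -(autE arho) -(autE arho').
Qed.
End HenonWords.

(** * Reduction of words and rigidity of all automorphisms *)

Section AllRigid.
#[local] Opaque henon henon_inv tri swp.
Variable K : closedFieldType.
Hypothesis char0 : [pchar K] =i pred0.
Local Notation T := {mpoly K[2]}.
Implicit Types (p q f g h : T) (P Q : {poly K}) (l : letter K) (ls : seq (letter K)).
Local Notation X := (mX K).
Local Notation Y := (mY K).

Lemma linear_polyE P : (size P <= 2)%N -> exists a b, P = a *: 'X + b%:P.
Proof.
move=> sP; exists P`_1, P`_0; apply/polyP => -[|[|i]]; rewrite coefD coefZ coefX coefC /=.
- by rewrite mulr0 add0r.
- by rewrite mulr1 addr0.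
- by rewrite mulr0 addr0 nth_default //; apply: leq_trans sP _.
Qed.

Lemma quadratic_root (a b c : K) : a != 0 -> exists s, a * s ^+ 2 + b * s + c = 0.
Proof.
move=> a0; pose q : {poly K} := a *: 'X^2 + (b *: 'X + c%:P).
have sq : size q != 1%N.
  rewrite /q size_polyDl size_scale // size_polyXn //.
  apply: leq_ltn_trans (size_polyD _ _) _; rewrite gtn_max; apply/andP; split.
    by apply: leq_ltn_trans (size_scale_leq _ _) _; rewrite size_polyX.
  by rewrite size_polyC; case: (_ != _).
have [s /rootP] := closed_rootP q sq; rewrite /q !(hornerD, hornerZ, hornerXn, hornerX, hornerC) => e.
by exists s; rewrite -addrA.
Qed.

Lemma rigid_affine_hen l : valid l -> (size (l_P l) <= 2)%N -> rigid (henon l).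
Proof.
case: l => al be ga P /andP[/= al0 be0] /linear_polyE [p1 [p0 eP]]; set l := Letter _ _ _ _.
have vl : valid l by rewrite /valid al0.
(* The form y + s x is an eigenvector up to constants when (s be + p1) s = al; taking it as new
   coordinate y makes the affine map triangular. *)
have [s es] := quadratic_root p1 (- al) be0.
pose t := shear s 1; have vt : valid t := valid_shear s 1.
pose th := @swp K \o (tri t \o @swp K); pose th' := @swp K \o (tri (linv t) \o @swp K).
have thK : cancel th th' by move=> p; rewrite /th /th' /= swpK triK // swpK.
have thVK : cancel th' th by move=> p; rewrite /th /th' /= swpK triVK // swpK.
have ath : is_Kalg_automorphism th.
  by apply: aut_comp; [exact: aut_swp | apply: aut_comp; [exact: aut_tri | exact: aut_swp]].
have ath' : is_Kalg_automorphism th'.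
  apply: aut_comp; first exact: aut_swp.
  by apply: aut_comp; [apply: aut_tri; exact: valid_linv | exact: aut_swp].
have thY : th Y = s *: X + Y.
  rewrite /th /= swpY triXE /triX /= scale1r expr1 evZ evX rmorphD /= linearZ /= swpX swpY.
  by rewrite addrC.
apply: (@rigid_ext _ ((henon l \o th) \o th')); first by move=> p; exact: (congr1 (henon l) (thVK p)).
apply: (@rigid_conj _ th' (henon l \o th) ath').
have [||l' vl' e] := @aut_tri_form _ char0 (th' \o (henon l \o th)) (s * be + p1) (s * ga + p0).
- exact: (aut_comp ath' (aut_comp (aut_hen vl) ath)).
- apply: (can_inj thK); rewrite [LHS]thVK [RHS](aut_lin _ _ _ ath) thY.
  have [hL _ _ _] := aut_hen vl; rewrite -[LHS]/(henon l (th Y)) thY hL henX henY /triX /triY /= eP evD evZ evX evC.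
  rewrite !scalerDr !scalerA.
  have -> : (s * be + p1) * s = al.
    by apply/eqP; rewrite -subr_eq0 -es; apply/eqP; ring.
  rewrite scalerDl mpolyCD -[s *: ga%:MP]mul_mpolyC -mpolyCM; ring.
by apply: rigid_ext (rigid_tri char0 vl') => p; rewrite e.
Qed.

Lemma rigid_tri_cw l ls : valid l -> all (@valid K) ls ->
  (forall ls', (size ls' <= size ls)%N -> all (@valid K) ls' -> rigid (henon_word ls')) ->
  rigid (tri l \o henon_word ls).
Proof.
move=> vl; case: ls => [|a ls] /= vls IH; first exact: rigid_tri.
case/andP: vls => va vls.
apply: (@rigid_ext _ (henon_word (lmul l a :: ls))); first by move=> p /=; rewrite tri_hen.
by apply: IH; rewrite //= valid_lmul.
Qed.

(** Bruhat decomposition: with [c] affine, swap-letter-swap is a single letter if p1 = 0 and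
    letter-swap-letter otherwise. The outer letters merge with their neighbours and the word gets
    shorter. *)
Lemma rigid_hen2_cw b c m : valid b -> valid c -> (size (l_P c) <= 2)%N ->
  all (@valid K) m ->
  (forall ls', (size ls' < (size m).+2)%N -> all (@valid K) ls' -> rigid (henon_word ls')) ->
  rigid (henon b \o (henon c \o henon_word m)).
Proof.
move=> vb; case: c => al be ga P /andP[/= al0 be0] /linear_polyE [p1 [p0 eP]] vm IH.
set c := Letter _ _ _ _.
have sX : swp (henon c X) = be *: X + ga%:MP.
  by rewrite henX /triY /= rmorphD /= linearZ /= swpY lrmorphC.
have sY : swp (henon c Y) = al *: Y + (p1 *: X + (p0)%:MP).
  rewrite henY /triX /= eP evD evZ evX evC.
  by rewrite rmorphD /= linearZ /= swpX rmorphD /= linearZ /= swpY lrmorphC.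
have [p1z|p1n] := eqVneq p1 0.
  pose c' := Letter be al p0 ga%:P.
  have vc' : valid c' by rewrite /valid /= be0.
  have ec' p : swp (henon c p) = tri c' p.
    apply: (@sub_ext _ (@swp K \o henon c) (tri c')); rewrite /=.
      by rewrite sX triXE /triX /= evC.
    by rewrite sY triYE /triY /= p1z scale0r add0r.
  apply: (@rigid_ext _ (tri (lmul b c') \o henon_word m)).
    by move=> p /=; rewrite -tri_lmul -ec'.
  apply: rigid_tri_cw => //; first exact: valid_lmul.
  by move=> ls' s' v'; apply: IH => //; apply: leq_ltn_trans s' _.
pose c1 := Letter p1 1 0 (al *: 'X + (p0)%:P).
(* Applying [henon c1] to y gives p1 x + al y + p0; the coefficients are chosen to leave be x +
   ga. *)
pose c2 := Letter (- (be * al / p1)) 1 0 ((be / p1) *: 'X + (ga - be * p0 / p1)%:P).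
have vc1 : valid c1 by rewrite /valid /= p1n oner_eq0.
have vc2 : valid c2 by rewrite /valid /= oppr_eq0 !mulf_eq0 invr_eq0 !negb_or be0 al0 p1n oner_eq0.
have ec p : swp (henon c p) = henon c1 (tri c2 p).
  apply: (@sub_ext _ (@swp K \o henon c) (henon c1 \o tri c2)).
    rewrite /= sX triXE /triX /= ev_lin.
    have [hL _ _ _] := aut_hen vc1; rewrite hL aut_lin; last exact: aut_hen.
    rewrite henX henY /triX /triY /= scale1r mpolyC0 addr0 ev_lin.
    rewrite !scalerDr !scalerA divfK // [be / p1 * al]mulrAC scaleNr mpolyCB.
    rewrite -[_ *: p0%:MP]mul_mpolyC -mpolyCM [be / p1 * p0]mulrAC.
    by move: (_ *: X) (_ *: Y) (mpolyC 2 ga) (mpolyC 2 (be * p0 / p1)) => x y z w; ring.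
  rewrite /= sY triYE /triY /= scale1r mpolyC0 addr0 henY.
  by rewrite /triX /= ev_lin addrCA.
apply: (@rigid_ext _ (henon (lmul b c1) \o (tri c2 \o henon_word m))).
  by move=> p /=; rewrite -tri_hen -ec.
case: m vm IH => [|a m] vm IH.
  apply: (@rigid_ext _ (henon (lmul b c1) \o tri c2)) => //.
  apply: rigid_conj; first exact: aut_tri.
  apply: (@rigid_ext _ (henon_word [:: lmul c2 (lmul b c1)])).
    by move=> p /=; rewrite tri_hen.
  by apply: IH; rewrite //= valid_lmul // valid_lmul.
case/andP: vm => va vm.
apply: (@rigid_ext _ (henon_word [:: lmul b c1, lmul c2 a & m])).
  by move=> p /=; rewrite tri_hen.
by apply: IH; rewrite //= !valid_lmul.
Qed.

Lemma rigid_cw ls : all (@valid K) ls -> rigid (henon_word ls).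
Proof.
have [k] := ubnP (size ls); elim: k ls => // k IH ls ltk vls.
have [ls0|ls0] := posnP (size ls).
  by rewrite (size0nil ls0) => D _ _ _ p.
pose good l := (2 < size (l_P l))%N.
have [gls|bad] := boolP (all good ls); first exact: rigid_henon.
rewrite -has_predC in bad; pose i := find (predC good) ls.
pose c := nth (lid K) ls i; pose l1 := take i ls; pose l2 := drop i.+1 ls.
have lti : (i < size ls)%N by rewrite -has_find.
have els : ls = l1 ++ c :: l2 by rewrite /l1 /l2 /c -drop_nth // cat_take_drop.
have sc : (size (l_P c) <= 2)%N by rewrite leqNgt; exact: (nth_find (lid K) bad).
move: vls; rewrite els all_cat /= => /and3P[v1 vc v2].
have := size_cat l2 l1; have : all (@valid K) (l2 ++ l1) by rewrite all_cat v2.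
(* Read cyclically after the bad letter [c], the rest of the word ends with its left neighbour [b];
   if there is none, the word is [c] alone. *)
case/lastP e : (l2 ++ l1) => [|m b] /=.
  move=> _ /esym /eqP; rewrite addn_eq0 => /andP[/eqP/size0nil e2 /eqP/size0nil e1].
  rewrite e1 e2 /=; exact: rigid_affine_hen.
rewrite all_rcons => /andP[vb vm] sz.
apply: (@rigid_ext _ (henon_word l1 \o henon_word (c :: l2))); first by move=> p; rewrite cw_cat.
apply: rigid_conj; first by apply: aut_cw; rewrite /= vc.
apply: (@rigid_ext _ (henon_word (c :: m) \o henon b)).
  by move=> p; rewrite /= -(cw_cat l2 l1 p) e -cats1 cw_cat.
apply: rigid_conj; first exact: aut_hen.
apply: rigid_hen2_cw => // ls' lt'; apply: IH.
move: sz lt' ltk; rewrite els size_cat size_rcons /=; clear; lia.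
Qed.

Lemma rigid_aut (rho : T -> T) : is_Kalg_automorphism rho -> rigid rho.
Proof.
move=> arho.
(* The trailing letter rotates to the front, where it merges into the first Henon map. The swap
   itself is the Henon map of the identity letter. *)
suff [ls [b [vls vb e]]] : exists ls b, [/\ all (@valid K) ls, valid b & henon_word ls \o tri b =1 rho].
  apply: rigid_ext e _; apply: rigid_conj; first exact: aut_tri.
  by apply: rigid_tri_cw => // ls' _; exact: rigid_cw.
move: rho arho; apply: (jung_ind char0) => [rho rho' e|l vl|l rho vl|rho].
- by move=> [ls [b [vls vb e']]]; exists ls, b; split=> // p; rewrite e' e.
- by exists [::], l.
- move=> [[|a ls] [b [vls vb e]]].
    by exists [::], (lmul l b); split=> [||p]; rewrite ?valid_lmul //= -tri_lmul -e.
  case/andP: vls => va vls; exists (lmul l a :: ls), b; split=> //.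
    by rewrite /= valid_lmul.
  by move=> p; rewrite /= -e /= tri_hen.
- move=> [ls [b [vls vb e]]]; exists (lid K :: ls), b; split=> //.
    by rewrite /= /valid /= oner_eq0.
  by move=> p; rewrite /= hen_lid -e.
Qed.
End AllRigid.

Theorem theorem1p1 (K : closedFieldType) (Kchar0 : [pchar K] =i pred0)
  (D : {mpoly K[2]} -> {mpoly K[2]}) :
  is_derivation D -> simple_derivation D ->
  forall rho : {mpoly K[2]} -> {mpoly K[2]}, in_Aut D rho -> rho =1 id.
Proof. by move=> dD sD rho [arho comm]; exact: (rigid_aut Kchar0 arho dD sD comm). Qed.
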